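(* Let $X, Y$ be finite dimensional Euclidean spaces, $A: X \to Y$ linear, $b \in Y$, $c \in X$, and $K \subseteq Y$ a nice closed convex cone. Consider the conic linear program $$(P)\qquad \sup\ \langle c, x\rangle \quad \text{s.t.}\quad b - Ax \in K,$$ assumed feasible, with minimal cone $F_{\min}$. Let $L = \{y \in Y : A^*y = 0,\ \langle b, y \rangle = 0\}$, let $\ell_K$ be the length of the longest chain of faces of $K$, and $\ell = \min\{\ell_K - 1, \dim L\}$. For each $u \in K^*$ let $\tan'(u, K^* ) \subseteq Y$ be a set such that for all $u \in K^*$: (i) $\tan'(u,K^* ) \subseteq \tan(u,K^* )$; and (ii) for all $v \in \tan(u,K^* )$ there exists $\lambda_v > 0$ such that $v \in \tan'(\lambda_v u, K^* )$. Let $(EXT'_{\rm nice, simple})$ be the system in the variables $(u_i, v_i)_{i=0}^{\ell+1}$, $u_i,v_i \in Y$: $$(u_0,v_0) = (0,0),\quad (u_i, v_i) \in K^* \times \tan'(u_{i-1}, K^* )\ (i = 1,\dots,\ell+1),\quad u_i + v_i \in L\ (i=1,\dots,\ell).$$ Then $$F_{\min}^* = \{\, u_{\ell+1} + v_{\ell+1} : (u_i,v_i)_{i=0}^{\ell+1} \text{ is feasible in } (EXT'_{\rm nice, simple}) \,\},$$ and the extended dual $$\inf\ \langle b, u_{\ell+1}+v_{\ell+1}\rangle \quad \text{s.t.}\quad A^*(u_{\ell+1}+v_{\ell+1}) = c,\ (u_i,v_i)_{i=0}^{\ell+1} \text{ is feasible in } (EXT'_{\rm nice, simple})$$ has strong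 duality with $(P)$. In particular, suppose $(P)$ is a semidefinite program: $X = \mathbb{R}^m$, $Y = \mathcal{S}^n$, $K = \mathcal{S}^n_+$, $Ax = \sum_{i=1}^m x_i a_i$ with $a_1, \dots, a_m \in \mathcal{S}^n$, and $a_1, \dots, a_m, b$ linearly independent. Then, with $\ell = \min\{ n,\ n(n+1)/2 - m - 1\}$, the problem $$\begin{array}{rll} \inf & \langle b, u_{\ell+1}+v_{\ell+1}\rangle & \\ \text{s.t.} & A^*(u_{\ell+1}+v_{\ell+1}) = c, & \\ & A^*(u_i+v_i) = 0,\ \langle b, u_i + v_i\rangle = 0, & i=1,\dots,\ell,\\ & u_i \succeq 0, & i=1,\dots,\ell+1,\\ & \begin{pmatrix} u_{i-1} & w_i \\ w_i^T & I\end{pmatrix} \succeq 0, & i=1,\dots,\ell+1,\\ & v_i = w_i + w_i^T, & i=1,\dots,\ell+1,\\ & w_i \in \mathbb{R}^{n\times n}, & i=1,\dots,\ell+1,\\ & (u_0,v_0) = (0,0) & \end{array}$$ has strong duality with $(P)$.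
   Context: $\mathcal{S}^n$ is the space of $n\times n$ real symmetric matrices with inner product $\langle x, z\rangle = \sum_{i,j} x_{ij}z_{ij}$, $\mathcal{S}^n_+$ the cone of positive semidefinite ones, $y \succeq 0$ means $y$ is positive semidefinite. For a set $C$, $C^\perp$ is the orthogonal complement of its linear span. For a cone $C$, $C^* = \{ z : \langle z, x\rangle \ge 0 \ \forall x \in C\}$. $A^*$ is the adjoint of $A$. A convex subset $F$ of a convex set $C$ is a face of $C$ if $x_1, x_2 \in C$ and $(x_1,x_2)\cap F \ne \emptyset$ imply $x_1, x_2 \in F$, where $(x_1,x_2)$ is the open line segment. A closed convex cone $K$ is nice if $K^* + E^\perp$ is closed for all faces $E$ of $K$. For $x$ in a convex set $C$, $\operatorname{dir}(x,C) = \{ y : x + ty \in C \text{ for some } t>0\}$ and $\tan(x,C) = \operatorname{cl}\operatorname{dir}(x,C) \cap -\operatorname{cl}\operatorname{dir}(x,C)$. The minimal cone $F_{\min}$ of feasible $(P)$ is the unique face of $K$ that contains $b - A\bar{x}$ in its relative interior, where $\bar x$ is any point in the relative interior of the feasible set of $(P)$. The length of a chain of faces is the number of (nonempty) faces in a strictly increasing chain (e.g. $\ell_K = n+1$ for $\mathcal{S}^n_+$). A minimization problem $(D')$ has strong duality with the feasible problem $(P)$ if: $(P)$ is bounded (has finite optimal value) if and only if $(D')$ is feasible; and when these equivalent conditions hold, the optimal values of $(P)$ and $(D')$ agree and the latter is attained. *)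

(* Defs.v *)
From HB Require Import structures.
From mathcomp Require Import all_boot all_order all_algebra.
From mathcomp Require Import all_classical all_reals all_analysis.
From mathcomp Require Import ring lra.

Set Implicit Arguments.
Unset Strict Implicit.
Unset Printing Implicit Defensive.

Import Order.TTheory GRing.Theory Num.Theory.
Import numFieldNormedType.Exports.

Local Open Scope classical_set_scope.
Local Open Scope ring_scope.

(* Finite-dimensional Euclidean spaces.  The library topology of such a space
   is the one of the norm, hence of the inner product. *)
HB.mixin Record NormedVector_isEuclidean (R : realType) E
    & Vector R E & NormedModule R E := {
  edot : E -> E -> R ;
  edotC : forall x y, edot x y = edot y x ;
  edot_linear : forall x, linear_for *%R (edot x) ;
  normE_edot : forall x : E, `|x| ^+ 2 = edot x x
}.

#[short(type="euclideanType")]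
HB.structure Definition Euclidean (R : realType) :=
  {E of Vector R E & NormedModule R E & NormedVector_isEuclidean R E}.

(* Builds the Euclidean norm from an inner product on a vector space. *)
HB.factory Record Vector_isEuclidean (R : realType) E & Vector R E := {
  vdot : E -> E -> R ;
  vdotC : forall x y, vdot x y = vdot y x ;
  vdot_linear : forall x, linear_for *%R (vdot x) ;
  vdot_ge0 : forall x, 0 <= vdot x x ;
  vdot_eq0 : forall x, vdot x x = 0 -> x = 0
}.

HB.builders Context R E & Vector_isEuclidean R E.

Let vdotDr x y z : vdot x (y + z) = vdot x y + vdot x z.
Proof. by have := vdot_linear x 1 y z; rewrite scale1r mul1r. Qed.

Let vdotr0 x : vdot x 0 = 0.
Proof. by have := vdotDr x 0 0; rewrite addr0; lra. Qed.

Let vdotZr a x y : vdot x (a *: y) = a * vdot x y.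
Proof. by have := vdot_linear x a y 0; rewrite vdotr0 !addr0. Qed.

Let vnorm (x : E) : R := Num.sqrt (vdot x x).

Let vdotD2 x y a : vdot (x + a *: y) (x + a *: y) =
  vdot x x + a * vdot x y *+ 2 + a ^+ 2 * vdot y y.
Proof.
rewrite vdotDr vdotZr [vdot _ x]vdotC [vdot _ y]vdotC !vdotDr !vdotZr.
by rewrite [vdot y x]vdotC; ring.
Qed.

Let cauchy_schwarz x y : vdot x y <= vnorm x * vnorm y.
Proof.
have [->|y0] := eqVneq y 0.
  by rewrite vdotr0 mulr_ge0 ?sqrtr_ge0.
have yy0 : 0 < vdot y y.
  by rewrite lt_def vdot_ge0 andbT; apply: contra_neq y0 => /vdot_eq0.
rewrite /vnorm -sqrtrM ?vdot_ge0// (le_trans (ler_norm _))//.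
rewrite -sqrtr_sqr ler_sqrt ?mulr_ge0 ?vdot_ge0//.
have := vdot_ge0 (x + (- (vdot x y / vdot y y)) *: y); rewrite vdotD2.
rewrite -(pmulr_rge0 _ yy0).
suff -> : vdot y y * (vdot x x + - (vdot x y / vdot y y) * vdot x y *+ 2 +
   (- (vdot x y / vdot y y)) ^+ 2 * vdot y y) =
   vdot x x * vdot y y - vdot x y ^+ 2 by rewrite subr_ge0.
by field; rewrite gt_eqF.
Qed.

Let vnormD x y : vnorm (x + y) <= vnorm x + vnorm y.
Proof.
rewrite -(@ler_pXn2r _ 2) ?nnegrE ?addr_ge0 ?sqrtr_ge0// sqrrD.
rewrite !sqr_sqrtr ?vdot_ge0//.
have := vdotD2 x y 1; rewrite !scale1r expr1n !mul1r => ->.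
by rewrite lerD2r lerD2l lerMn2r cauchy_schwarz orbT.
Qed.

Let vnormZ a x : vnorm (a *: x) = `|a| * vnorm x.
Proof.
rewrite /vnorm vdotZr vdotC vdotZr mulrA -expr2 sqrtrM ?sqr_ge0//.
by rewrite sqrtr_sqr.
Qed.

Let vnorm_eq0 x : vnorm x = 0 -> x = 0.
Proof.
move=> /eqP; rewrite sqrtr_eq0 => xx0; apply: vdot_eq0.
by apply/eqP; rewrite eq_le xx0 vdot_ge0.
Qed.

HB.instance Definition _ := Lmodule_isNormed.Build R E vnormD vnormZ vnorm_eq0.

Let sqr_vnorm (x : E) : `|x| ^+ 2 = vdot x x.
Proof. by rewrite [`|x|]/(vnorm x) sqr_sqrtr// vdot_ge0. Qed.

HB.instance Definition _ :=
  NormedVector_isEuclidean.Build R E vdotC vdot_linear sqr_vnorm.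

HB.end.

(* The library norm on 'rV[R]_m is the sup norm, hence the alias. *)
Definition euclid (R : realType) (m : nat) := 'rV[R]_m.

Section Euclid.
Variables (R : realType) (m : nat).

HB.instance Definition _ := Vector.copy (euclid R m) 'rV[R]_m.

Definition rvdot (x y : euclid R m) : R := \sum_i (x : 'rV_m) 0 i * (y : 'rV_m) 0 i.

Let rvdotC x y : rvdot x y = rvdot y x.
Proof. by apply: eq_bigr => i _; rewrite mulrC. Qed.

Let rvdot_linear x : linear_for *%R (rvdot x).
Proof.
move=> a y z; rewrite /rvdot mulr_sumr -big_split/=; apply: eq_bigr => i _.
by rewrite !mxE; ring.
Qed.

Let rvdot_ge0 x : 0 <= rvdot x x.
Proof. by apply: sumr_ge0 => i _; rewrite -expr2 sqr_ge0. Qed.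

Let rvdot_eq0 x : rvdot x x = 0 -> x = 0.
Proof.
move=> /eqP; rewrite psumr_eq0 => [/allP xx0|i _]; last first.
  by rewrite -expr2 sqr_ge0.
apply/rowP => i; rewrite mxE; have := xx0 i (mem_index_enum i).
by rewrite /= mulf_eq0 orbb => /eqP.
Qed.

HB.instance Definition _ := Vector_isEuclidean.Build R (euclid R m)
  rvdotC rvdot_linear rvdot_ge0 rvdot_eq0.

End Euclid.

Definition sub_trmx (R : realType) (n : nat) (M : 'M[R]_n) : 'M[R]_n := M - M^T.

Lemma sub_trmx_is_linear (R : realType) (n : nat) : linear (@sub_trmx R n).
Proof. by move=> a M N; apply/matrixP=> i j; rewrite !mxE; ring. Qed.

HB.instance Definition _ (R : realType) (n : nat) :=
  GRing.isLinear.Build R 'M[R]_n 'M[R]_n *:%R (@sub_trmx R n)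
    (@sub_trmx_is_linear R n).

Definition symmx_vs (R : realType) (n : nat) : {vspace 'M[R]_n} :=
  lker (linfun (@sub_trmx R n)).

Lemma mem_symmx_vs (R : realType) (n : nat) (M : 'M[R]_n) :
  (M \in symmx_vs R n) = (M^T == M).
Proof. by rewrite memv_ker lfunE/= subr_eq0 eq_sym. Qed.

Definition symmx (R : realType) (n : nat) := subvs_of (symmx_vs R n).
Notation "''S[' R ]_ n" := (symmx R n)
  (at level 8, n at level 2, format "''S[' R ]_ n") : type_scope.

Definition mx_of_sym (R : realType) (n : nat) (x : 'S[R]_n) : 'M[R]_n := vsval x.
Arguments mx_of_sym : simpl never.
Coercion mx_of_sym : symmx >-> matrix.

Section Symmx.
Variables (R : realType) (n : nat).

HB.instance Definition _ := Vector.copy 'S[R]_n (subvs_of (symmx_vs R n)).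

Lemma mx_of_sym_is_linear : linear (@mx_of_sym R n).
Proof. by move=> a x y; exact: (linearP (vsval : subvs_of (symmx_vs R n) -> _)). Qed.

HB.instance Definition _ := GRing.isLinear.Build R 'S[R]_n 'M[R]_n *:%R
  (@mx_of_sym R n) mx_of_sym_is_linear.

Definition mxdot (x z : 'S[R]_n) : R := \sum_i \sum_j x i j * z i j.

Let mxdotC x z : mxdot x z = mxdot z x.
Proof. by do 2 apply: eq_bigr => ? _; rewrite mulrC. Qed.

Let mxdot_linear x : linear_for *%R (mxdot x).
Proof.
move=> a y z; rewrite /mxdot mulr_sumr -big_split/=; apply: eq_bigr => i _.
rewrite mulr_sumr -big_split/=; apply: eq_bigr => j _.
by rewrite linearP !mxE; ring.
Qed.

Let mxdot_ge0 x : 0 <= mxdot x x.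
Proof. by do 2 apply: sumr_ge0 => ? _; rewrite -expr2 sqr_ge0. Qed.

Let mxdot_eq0 x : mxdot x x = 0 -> x = 0.
Proof.
move=> /eqP; rewrite psumr_eq0 => [/allP xx0|i _]; last first.
  by apply: sumr_ge0 => j _; rewrite -expr2 sqr_ge0.
apply/val_inj/matrixP => i j; rewrite -[val x]/(mx_of_sym x) -[val 0]/(mx_of_sym 0).
rewrite linear0 mxE.
have := xx0 i (mem_index_enum i).
rewrite /= psumr_eq0 => [/allP/(_ j (mem_index_enum j))|? _]; last first.
  by rewrite -expr2 sqr_ge0.
by rewrite /= mulf_eq0 orbb => /eqP.
Qed.

HB.instance Definition _ := Vector_isEuclidean.Build R 'S[R]_n
  mxdotC mxdot_linear mxdot_ge0 mxdot_eq0.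

End Symmx.

Definition psdmx (R : realType) (n : nat) (M : 'M[R]_n) : Prop :=
  M^T = M /\ forall x : 'cV[R]_n, 0 <= (x^T *m M *m x) 0 0.

Definition psd_cone (R : realType) (n : nat) : set 'S[R]_n :=
  [set x | psdmx (x : 'M[R]_n)].
Arguments psd_cone : clear implicits.

Section Convex.
Variables (R : realType) (Y : euclideanType R).
Implicit Types (x y z : Y) (C F K : set Y).

Definition lin_span C : set Y :=
  [set y | forall V : {vspace Y}, (forall x, C x -> x \in V) -> y \in V].

Definition aff_hull C : set Y :=
  [set y | forall (p : Y) (V : {vspace Y}),
     (forall x, C x -> x - p \in V) -> y - p \in V].

Definition relint C : set Y :=
  [set x | C x /\ \forall y \near x, aff_hull C y -> C y].

Definition perp C : set Y := [set z | forall x, lin_span C x -> edot z x = 0].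

Definition dual_cone C : set Y := [set z | forall x, C x -> 0 <= edot z x].

Definition cone C := forall (t : R) x, 0 <= t -> C x -> C (t *: x).

Definition closed_convex_cone C := [/\ closed C, convex_set C & cone C].

Definition open_segment x1 x2 : set Y :=
  [set y | exists t : R, [/\ 0 < t, t < 1 & y = (1 - t) *: x1 + t *: x2]].

Definition face C F :=
  [/\ F `<=` C, convex_set F &
    forall x1 x2, C x1 -> C x2 -> open_segment x1 x2 `&` F !=set0 ->
      F x1 /\ F x2].

Definition nice_cone K :=
  closed_convex_cone K /\
  forall E, face K E -> closed [set y + z | y in dual_cone K & z in perp E].

Definition feas_dir x C : set Y := [set y | exists2 t : R, 0 < t & C (x + t *: y)].

Definition tangent_space x C : set Y :=
  closure (feas_dir x C) `&` [set y | closure (feas_dir x C) (- y)].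

Definition face_chain K (k : nat) (F : 'I_k -> set Y) :=
  (forall i, face K (F i) /\ F i !=set0) /\
  (forall i j : 'I_k, (i < j)%N -> F i `<` F j).

(* Lengths are bounded (by \dim Y + 1 when K is convex), so that the supremum
   is the length of a longest chain. *)
Definition longest_face_chain K : nat :=
  supremum 0%N [set k | exists F : 'I_k -> set Y, face_chain K F].

End Convex.

Section ConicProgram.
Variables (R : realType) (X Y : euclideanType R).
Implicit Types (A : 'Hom(X, Y)) (b : Y) (K : set Y).

(* The only linear map satisfying the condition; 0 is a dummy default value. *)
Definition adjoint A : 'Hom(Y, X) :=
  xget 0 [set B : 'Hom(Y, X) | forall x y, edot (A x) y = edot x (B y)].

Definition feasible A b K : set X := [set x | K (b - A x)].

(* There is exactly one such face when the program is feasible and K is convex;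
   set0 is a dummy default value. *)
Definition minimal_cone A b K : set Y :=
  xget set0 [set F | face K F /\
    forall x, relint (feasible A b K) x -> relint F (b - A x)].

Definition edotr b (y : Y) : R^o := edot b y.

Lemma edotr_is_linear b : linear (edotr b).
Proof. exact: edot_linear. Qed.

HB.instance Definition _ b :=
  GRing.isLinear.Build R Y R^o *:%R (edotr b) (edotr_is_linear b).

Definition annihilator A b : {vspace Y} :=
  (lker (adjoint A) :&: lker (linfun (edotr b)))%VS.

Lemma mem_annihilator A b y :
  (y \in annihilator A b) = (adjoint A y == 0) && (edot b y == 0).
Proof. by rewrite memv_cap !memv_ker lfunE. Qed.

End ConicProgram.

(* (P) is the problem sup {f x | x in P}, (D) is inf {g z | z in D}. *)
Definition strong_duality (R : realType) (T T' : Type) (P : set T) (f : T -> R)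
    (D : set T') (g : T' -> R) : Prop :=
  let vP : \bar R := ereal_sup [set (f x)%:E | x in P] in
  let vD : \bar R := ereal_inf [set (g z)%:E | z in D] in
  (vP \is a fin_num <-> D !=set0) /\
  (vP \is a fin_num -> vP = vD /\ exists2 z, D z & (g z)%:E = vD).

(* The tuples are u = (u_0, ..., u_{l+1}) and v = (v_0, ..., v_{l+1}). *)
Definition ext_nice_simple (R : realType) (Y : euclideanType R) (K : set Y)
    (tan' : Y -> set Y) (L : {vspace Y}) (l : nat) (u v : l.+2.-tuple Y) : Prop :=
  [/\ u`_0 = 0, v`_0 = 0,
    forall i, (1 <= i <= l.+1)%N ->
      dual_cone K u`_i /\ tan' u`_i.-1 v`_i &
    forall i, (1 <= i <= l)%N -> u`_i + v`_i \in L].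

(* The w_i are indexed from 1, so that w_i is the entry i - 1 of w. *)
Definition sdp_ext_dual_feasible (R : realType) (m n : nat)
    (A : 'Hom(euclid R m, 'S[R]_n)) (b : 'S[R]_n) (c : euclid R m) (l : nat)
    (u v : l.+2.-tuple 'S[R]_n) (w : l.+1.-tuple 'M[R]_n) : Prop :=
  [/\ adjoint A (u`_l.+1 + v`_l.+1) = c,
    forall i, (1 <= i <= l)%N ->
      adjoint A (u`_i + v`_i) = 0 /\ edot b (u`_i + v`_i) = 0,
    forall i, (1 <= i <= l.+1)%N ->
      [/\ psd_cone R n u`_i,
        psdmx (block_mx (mx_of_sym u`_i.-1) w`_i.-1 (w`_i.-1)^T 1%:M) &
        mx_of_sym v`_i = w`_i.-1 + (w`_i.-1)^T],
    u`_0 = 0 & v`_0 = 0].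

(* Main.v *)
(** The minimal cone is the last face of a facial reduction: if the affine set
[b - A x] misses the relative interior of a face [F] of [K], then some [y] in
[L] is nonnegative on [F], not zero on [F], and so cuts out a smaller face.
Every face reached is exposed, namely [K] intersected with the orthogonal of
some [u] in the dual of [K].  By niceness [y] splits as [u' + v'] with [u'] in
the dual of [K] and [v'] orthogonal to this face, that is, in the tangent space
of the dual of [K] at [u].  Accumulating the splittings,
[(u_i, v_i) = (u_(i-1), v_(i-1)) + (u', v')], makes step [i] depend on
[u_(i-1)] only.  There are at most [l] steps because the faces decrease strictly
and the [u_i + v_i] are linearly independent.  Passing from [tan] to [tan']
amounts to rescaling the pairs, the last one first.  Over the minimal cone
Slater's condition holds, hence strong duality.

Separation needs no compactness: a convex cone which is not a subspace has a
nonnegative functional that is not zero on it, by extending a functional one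
vector at a time (M. Riesz); and a point outside a closed cone stays outside
when it is moved slightly towards the relative interior.

In the semidefinite case the number of steps is bounded by [n] because the
ranks of the [u_i] increase strictly. *)

Require Import Defs.
From HB Require Import structures.
From mathcomp Require Import all_boot all_order all_algebra.
From mathcomp Require Import all_classical all_reals all_analysis.
From mathcomp Require Import ring lra zify.

Set Implicit Arguments.
Unset Strict Implicit.
Unset Printing Implicit Defensive.

Import Order.TTheory GRing.Theory Num.Theory.
Import numFieldNormedType.Exports.
Import VectorInternalTheory.

Local Open Scope classical_set_scope.
Local Open Scope ring_scope.

(** * Separation of convex cones *)

Section Coordinates.
Variables (K : fieldType) (V : vectType K).
Implicit Types x y : V.

(** Vector identities are proved one coordinate at a time, where [ring] and [field] apply. *)
Definition crd i x : K := v2r x 0 i.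

Lemma crdP x y : (forall i, crd i x = crd i y) -> x = y.
Proof. by move=> xy; apply: (can_inj v2rK); apply/rowP => i; exact: xy. Qed.

Lemma crdD i x y : crd i (x + y) = crd i x + crd i y.
Proof. by rewrite /crd linearD mxE. Qed.

Lemma crdN i x : crd i (- x) = - crd i x.
Proof. by rewrite /crd linearN mxE. Qed.

Lemma crdZ i a x : crd i (a *: x) = a * crd i x.
Proof. by rewrite /crd linearZ mxE. Qed.

Lemma crd0 i : crd i 0 = 0.
Proof. by rewrite /crd linear0 mxE. Qed.

Definition crdE := (crdD, crdN, crdZ, crd0).

(** The functional is the coordinate along [x] in the free family made of [x] and a basis of [U]. *)
Lemma functional_separates (U : {vspace V}) x : x \notin U ->
  exists2 g : 'Hom(V, K^o), {in U, forall u, g u = 0} & g x = 1.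
Proof.
move=> xU; pose X := [tuple of x :: vbasis U].
have fX : free X.
  by rewrite free_cons (span_basis (vbasisP U)) xU (basis_free (vbasisP U)).
exists (linfun (coord X ord0 : V -> K^o)) => [u uU|]; rewrite lfunE/=; last first.
  by rewrite -[x in LHS]/(X`_(ord0 : 'I_(\dim U).+1)) coord_free.
rewrite (coord_vbasis uU) linear_sum/= big1// => i _; rewrite linearZ/=.
have -> : (vbasis U)`_i = X`_(lift ord0 i) by [].
by rewrite coord_free// mulr0.
Qed.

(** Each vector of [S] outside the current span raises its dimension; [n] bounds the codimension
    left. *)
Lemma span_set (S : set V) : exists e : seq V,
  (forall x, x \in e -> S x) /\ forall x, S x -> x \in <<e>>%VS.
Proof.
suff: forall n (e : seq V), (forall x, x \in e -> S x) ->
    (\dim {:V} <= n + \dim <<e>>)%N -> exists e : seq V,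
    (forall x, x \in e -> S x) /\ forall x, S x -> x \in <<e>>%VS.
  by move=> /(_ (\dim {:V}) [::]); apply => //; rewrite leq_addr.
elim=> [|n IH] e eS le_n.
  exists e; split=> // x _; suff -> : <<e>>%VS = fullv by rewrite memvf.
  by apply/eqP; rewrite eqEdim subvf.
have [eT|/existsNP[x /not_implyP[Sx /negP xe]]] :=
  pselect (forall x, S x -> x \in <<e>>%VS); first by exists e.
apply: (IH (x :: e)) => [y|]; first by rewrite inE => /predU1P[->//|/eS].
rewrite (leq_trans le_n)// addSn -addnS leq_add2l ltnNge.
apply: contra xe => le_e; rewrite span_cons in le_e.
have /eqP -> : (<<e>> == <[x]> + <<e>>)%VS by rewrite eqEdim le_e addvSr.
by rewrite (subvP (addvSl _ _))// memv_line.
Qed.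

End Coordinates.

Section Cones.
Variables (R : realType) (V : vectType R).
Implicit Types (C : set V) (x y r d : V).

(** Nonempty by its first clause, whereas [closed_convex_cone] admits the empty set. *)
Definition convex_cone C :=
  [/\ C 0, forall x y, C x -> C y -> C (x + y) &
      forall (t : R) x, 0 <= t -> C x -> C (t *: x)].

Definition cvx C := forall x y (t : R), 0 <= t -> t <= 1 -> C x -> C y ->
  C (t *: x + (1 - t) *: y).

(** The body is that of [feas_dir], on a space without inner product, because separation is also
    applied in [Y * R^o]. *)
Definition dirs C x : set V := [set d | exists2 t : R, 0 < t & C (x + t *: d)].

(* The relative interior of a convex set, described without topology. *)
Definition core C r := C r /\ forall x, C x -> dirs C r (r - x).

Lemma convex_cone_cvx C : convex_cone C -> cvx C.
Proof.
move=> [_ CD CZ] x y t t0 t1 Cx Cy.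
by apply: CD; apply: CZ; rewrite // subr_ge0.
Qed.

Lemma dirs_cone C r : cvx C -> C r -> convex_cone (dirs C r).
Proof.
move=> cC Cr; split=> [|x y [s s0 Cs] [t t0 Ct]|t x t0 [s s0 Cs]].
- by exists 1 => //; rewrite scaler0 addr0.
(* The new point is the mean of the two given ones, with weights [t / (s + t)] and [s / (s + t)]. *)
- exists (s * t / (s + t)); first by rewrite divr_gt0 ?mulr_gt0 ?addr_gt0.
  have st0 : s + t != 0 by rewrite gt_eqF// addr_gt0.
  have := cC _ _ (t / (s + t)) _ _ Cs Ct.
  rewrite divr_ge0 ?ler_pdivrMr ?addr_gt0 ?mul1r ?lerDr ?ltW ?addr_gt0//.
  move=> /(_ isT isT); congr C; apply: crdP => i; rewrite !crdE.
  by field.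
- move: t0; rewrite le_eqVlt => /predU1P[<-|t0].
    by exists 1 => //; rewrite scale0r scaler0 addr0.
  by exists (s / t); rewrite ?divr_gt0// scalerA mulfVK// gt_eqF.
Qed.

Lemma convex_cone_span C (e : seq V) : convex_cone C ->
  (forall x, x \in e -> C x /\ C (- x)) -> forall x, x \in <<e>>%VS -> C x.
Proof.
move=> [C0 CD CZ]; elim: e => [_ x|y e IH eC x].
  by rewrite span_nil memv0 => /eqP ->.
rewrite span_cons => /memv_addP[_ /vlineP[k ->] [z ze ->]].
apply: CD; last by apply: IH ze => w we; apply: eC; rewrite inE we orbT.
have [Cy CNy] := eC y (mem_head _ _).
have [k0|k0] := leP 0 k; first exact: CZ.
by rewrite -[k]opprK scaleNr -scalerN; apply: CZ; rewrite // oppr_ge0 ltW.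
Qed.

(** The finite case of [core_ex]. Moving [r] halfway to each new point [y] makes the direction away
    from [y] feasible and keeps the earlier ones, by averaging with [y]. *)
Lemma core_seq C (s : seq V) p : cvx C -> C p -> (forall x, x \in s -> C x) ->
  exists2 r, C r & forall x, x \in p :: s -> dirs C r (r - x).
Proof.
move=> cC Cp; elim: s => [_|y s IH Cs].
  exists p => // x; rewrite inE => /eqP ->.
  by exists 1 => //; rewrite subrr scaler0 addr0.
have [|r Cr Dr] := IH; first by move=> x xs; apply: Cs; rewrite inE xs orbT.
have Cy : C y by apply: Cs; rewrite mem_head.
have h2 : (0:R) <= 1/2 by lra.
have h21 : 1/2 <= (1:R) by lra.
have Cm : C (2^-1 *: (r + y)).
  have := cC _ _ _ h2 h21 Cr Cy; congr C; apply: crdP => i; rewrite !crdE; by field.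
exists (2^-1 *: (r + y)) => // x xs.
have [_ DD _] := dirs_cone cC Cm.
have Dy : dirs C (2^-1 *: (r + y)) (2^-1 *: (r - y)).
  exists 1 => //; have := Cr; congr C; apply: crdP => i; rewrite !crdE; by field.
have Dy' : dirs C (2^-1 *: (r + y)) (2^-1 *: (y - r)).
  exists 1 => //; have := Cy; congr C; apply: crdP => i; rewrite !crdE; by field.
have [->|xy] := eqVneq x y.
  by have := Dy; congr dirs; apply: crdP => i; rewrite !crdE; field.
have {}xs : x \in p :: s by move: xs; rewrite !inE (negbTE xy).
have [t t0 Ct] := Dr _ xs.
have Dx : dirs C (2^-1 *: (r + y)) (r - x).
  exists (t / 2); first by rewrite divr_gt0.
  have := cC _ _ _ h2 h21 Ct Cy; congr C; apply: crdP => i; rewrite !crdE; by field.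
have := DD _ _ Dx Dy'; congr dirs; apply: crdP => i; rewrite !crdE; by field.
Qed.

(** The feasible directions at [r] form a convex cone containing [x - r] and [r - x] for all [x] in
    [C], hence the span of these differences. *)
Lemma core_span C r : cvx C -> core C r ->
  exists2 e : seq V, (forall x, C x -> x - r \in <<e>>%VS) &
    forall x, x \in <<e>>%VS -> dirs C r x.
Proof.
move=> cC [Cr Dr]; have [e [eC Ce]] := span_set [set x - r | x in C].
exists e => [x Cx|]; first by apply: Ce; exists x.
apply: convex_cone_span => [|x /eC[y Cy <-]]; first exact: dirs_cone.
split; last by rewrite opprB; exact: Dr.
by exists 1 => //; rewrite scale1r addrC subrK.
Qed.

Lemma core_ex C p : cvx C -> C p -> exists r, core C r.
Proof.
move=> cC Cp; have [e [eC Ce]] := span_set [set x - p | x in C].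
have [|r Cr Dr] := core_seq (s := [seq x + p | x <- e]) cC Cp.
  by move=> _ /mapP[x /eC[y Cy <-] ->]; rewrite subrK.
exists r; split=> // y Cy; have [_ DD DZ] := dirs_cone cC Cr.
have Dp : dirs C r (p - r) by exists 1 => //; rewrite scale1r addrC subrK.
have Dp' := Dr p (mem_head _ _).
(* Since [r - y = - (y - p) + (r - p)], it suffices that both signs of each of the finitely many
   generators [x] of the span of [C - p] are feasible at [r]. *)
have : dirs C r (- (y - p)).
  apply: (convex_cone_span (dirs_cone cC Cr)) => [x xe|]; last first.
    by rewrite memvN; apply: Ce; exists y.
  have xs : x + p \in p :: [seq x + p | x <- e].
    by rewrite inE; apply/orP; right; apply/mapP; exists x.
  split.
    have : dirs C r (x + p - r).
      exists 1 => //; rewrite scale1r addrC subrK.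
      by have [z Cz <-] := eC _ xe; rewrite subrK.
    by move=> /DD/(_ Dp'); congr dirs; apply: crdP => i; rewrite !crdE; ring.
  by have := DD _ _ (Dr _ xs) Dp; congr dirs; apply: crdP => i; rewrite !crdE; ring.
move=> /DD/(_ Dp'); congr dirs; apply: crdP => i; rewrite !crdE; ring.
Qed.

(** The point [x] is the mean of [r] and [x + t (x - r)] with weights [t / (1 + t)] and
    [1 / (1 + t)], so the directions [r - y] feasible at [r] stay feasible at [x]; then
    [x - y = (x - r) + (r - y)]. *)
Lemma core_between C r x (t : R) : cvx C -> core C r -> C x -> 0 < t ->
  C (x + t *: (x - r)) -> core C x.
Proof.
move=> cC [Cr Dr] Cx t0 Ct; split=> // y Cy.
have [_ DD DZ] := dirs_cone cC Cx.
have Dxr : dirs C x (x - r) by exists t.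
have Dry : dirs C x (t * (1 + t)^-1 *: (r - y)).
  have [s s0 Cs] := Dr y Cy.
  exists s => //.
  have := cC _ _ (t / (1 + t)) _ _ Cs Ct.
  have t1 : 0 < 1 + t by lra.
  rewrite divr_ge0 ?ler_pdivrMr ?mul1r ?lerDr// ?ltW// => /(_ isT isT).
  have t10 : 1 + t != 0 by rewrite gt_eqF.
  by congr C; apply: crdP => i; rewrite !crdE; field.
have t1 : 0 < (1 + t) / t by rewrite divr_gt0//; lra.
have := DD _ _ Dxr (DZ _ _ (ltW t1) Dry).
congr dirs; apply: crdP => i; rewrite !crdE; field.
by rewrite gt_eqF ?andbT ?gt_eqF//; lra.
Qed.

(** Core points of a cone are order units, which is what the extension of positive functionals
    requires. *)
Lemma core_unit C r x : convex_cone C -> core C r -> C x ->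
  exists2 t : R, 0 < t & C (r - t *: x).
Proof.
move=> [_ _ CZ] [Cr Dr] Cx; have [t t0 Ct] := Dr x Cx.
have t1 : 0 < 1 + t by lra.
exists (t / (1 + t)); first by rewrite divr_gt0.
have := CZ (1 + t)^-1 _ _ Ct; rewrite invr_ge0 ltW// => /(_ isT).
congr C; apply: crdP => i; rewrite !crdE; field; by rewrite gt_eqF.
Qed.

(** * Extension of positive functionals (M. Riesz) *)

Section Extension.
Variables (C : set V) (r : V).
Hypotheses (cC : convex_cone C) (CNr : ~ C (- r)).
Hypothesis Cunit : forall x, C x -> exists2 t : R, 0 < t & C (r - t *: x).

(** Induction on [e]: a functional positive on [U] is extended to one more vector [x] by choosing
    its value [al] there. *)
Lemma positive_extension (e : seq V) : (forall x, x \in e -> C x) ->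
  exists2 f : 'Hom(V, R^o), f r = 1 &
    forall y, y \in (<[r]> + <<e>>)%VS -> C y -> 0 <= f y.
Proof.
have [C0 CD CZ] := cC.
elim: e => [_|x e IH eC].
  have r0 : r \notin 0%VS.
    by rewrite memv0; apply/eqP => r0; apply: CNr; rewrite r0 oppr0.
  have [g _ g1] := functional_separates r0; exists g => // y.
  rewrite span_nil addv0 => /vlineP[k ->] Ck; rewrite linearZ/= g1 [_ *: _]mulr1.
  rewrite leNgt; apply/negP => k0; apply: CNr.
  have := CZ (- k^-1) _ _ Ck; rewrite oppr_ge0 invr_le0 ltW// => /(_ isT).
  by rewrite scalerA mulNr mulVf ?lt_eqF// scaleN1r.
have [|f fr f0] := IH; first by move=> y ye; apply: eC; rewrite inE ye orbT.
have Cx : C x by apply: eC; rewrite mem_head.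
set U := (<[r]> + <<e>>)%VS in f0.
have UE : (<[r]> + <<x :: e>>)%VS = (<[x]> + U)%VS.
  by rewrite span_cons !addvA; congr (_ + _)%VS; rewrite addvC.
have [xU|xU] := boolP (x \in U).
  have -> : (<[r]> + <<x :: e>>)%VS = U; last by exists f.
  by rewrite UE; apply/addv_idPr; rewrite -memvE.
have rU : r \in U by rewrite (subvP (addvSl _ _))// memv_line.
have [g gU gx] := functional_separates xU.
(* Positivity at [k x + u] asks for [f u' <= al] if [x - u'] is in [C] (case [0 < k]) and
   [al <= f u0] if [u0 - x] is in [C] (case [k < 0]). Lower values never exceed upper ones, because
   [u0 - u'] is then in [C]; the order unit provides an upper one. *)
pose E := [set f u | u in [set u | u \in U /\ C (x - u)]].
have [t t0 Ct] := Cunit Cx.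
have ubE u0 : u0 \in U -> C (u0 - x) -> ubound E (f u0).
  move=> u0U Cu0 _ [u [uU Cu] <-].
  rewrite -subr_ge0 -linearB; apply: f0; first by rewrite rpredB.
  by have := CD _ _ Cu0 Cu; rewrite addrA subrK.
have supE : has_sup E.
  split; first by exists (f 0), 0 => //=; rewrite mem0v subr0.
  exists (f (t^-1 *: r)); apply: ubE; first by rewrite rpredZ.
  have := CZ t^-1 _ _ Ct; rewrite invr_ge0 ltW// => /(_ isT).
  by rewrite scalerBr scalerA mulVf ?gt_eqF// scale1r.
pose al := sup E.
(* As [g] vanishes on [U] and [g x = 1], this agrees with [f] on [U] and takes the value [al] at
   [x]. *)
exists (f + (al - f x) *: g) => [|y].
  by rewrite add_lfunE scale_lfunE (gU r)// scaler0 addr0.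
rewrite UE => /memv_addP[_ /vlineP[k ->] [u uU ->]] Cy.
have -> : (f + (al - f x) *: g)%R (k *: x + u) = k * al + f u.
  rewrite add_lfunE scale_lfunE !linearD !linearZ/= (gU u)// gx ?scaler0 ?addr0.
  by rewrite /GRing.scale/=; ring.
have [k0|k0|k0] := ltgtP k 0; last first.
- by rewrite k0 mul0r add0r; apply: f0 => //; move: Cy; rewrite k0 scale0r add0r.
- have : f (- k^-1 *: u) <= al.
    apply: ub_le_sup; [by have [] := supE|exists (- k^-1 *: u) => //].
    split; first by rewrite rpredZ.
    have := CZ k^-1 _ _ Cy; rewrite invr_ge0 ltW// => /(_ isT).
    by rewrite scalerDr scalerA mulVf ?gt_eqF// scale1r scaleNr opprK.
  rewrite linearZ /= /GRing.scale/= -(ler_pM2l k0).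
  by rewrite mulrA mulrN mulfV ?gt_eqF//; lra.
- have : al <= f (- k^-1 *: u).
    apply: ge_sup; [by have [] := supE|apply: ubE; first by rewrite rpredZ].
    have := CZ (- k^-1) _ _ Cy; rewrite oppr_ge0 invr_le0 ltW// => /(_ isT).
    rewrite scalerDr scalerA mulNr mulVf ?lt_eqF// scaleN1r.
    by congr C; rewrite addrC.
  rewrite linearZ /= /GRing.scale/= -(ler_nM2l k0).
  by rewrite mulrA mulrN mulfV ?lt_eqF//; lra.
Qed.

End Extension.

(** If [- r] were outside [C] for a core point [r], the extension would give a positive functional
    with value 1 at [r]. With [- r] in [C], [- x] is a positive multiple of [(r - t x) + (- r)]. *)
Lemma cone_opp C : convex_cone C ->
  (forall f : 'Hom(V, R^o), (forall x, C x -> 0 <= f x) ->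
     forall x, C x -> f x = 0) ->
  forall x, C x -> C (- x).
Proof.
move=> cC Cf; have [C0 CD CZ] := cC.
have [r rC] := core_ex (convex_cone_cvx cC) C0; have [Cr _] := rC.
have CNr : C (- r).
  apply: contrapT => CNr; have [e [eC Ce]] := span_set C.
  have [f fr f0] := positive_extension cC CNr (fun x => core_unit cC rC) eC.
  have Cf0 x : C x -> 0 <= f x.
    by move=> Cx; apply: f0 => //; rewrite (subvP (addvSr _ _))// Ce.
  by have /eqP := Cf f Cf0 r Cr; rewrite fr oner_eq0.
move=> x Cx; have [t t0 Ct] := core_unit cC rC Cx.
have := CZ t^-1 _ _ (CD _ _ Ct CNr); rewrite invr_ge0 ltW// => /(_ isT).
by congr C; apply: crdP => i; rewrite !crdE; field; rewrite gt_eqF.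
Qed.

Lemma core_functional_eq0 C (r : V) (f : 'Hom(V, R^o)) : convex_cone C -> core C r ->
  (forall x, C x -> 0 <= f x) -> f r = 0 -> forall x, C x -> f x = 0.
Proof.
move=> cC rC f0 fr x Cx; have [t t0 Ct] := core_unit cC rC Cx.
apply/eqP; rewrite eq_le f0// andbT -(pmulr_rle0 _ t0).
by have := f0 _ Ct; rewrite linearB linearZ/= fr sub0r oppr_ge0.
Qed.

End Cones.

(** * Euclidean spaces *)

Section EuclideanFacts.
Variables (R : realType) (Y : euclideanType R).
Implicit Types (x y z d : Y) (C D F K S : set Y).

Lemma edotDr x y z : edot x (y + z) = edot x y + edot x z.
Proof. exact: (linearD (edotr x)). Qed.
Lemma edotZr a x y : edot x (a *: y) = a * edot x y.
Proof. exact: (linearZ_LR (edotr x)). Qed.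
Lemma edotNr x y : edot x (- y) = - edot x y.
Proof. exact: (linearN (edotr x)). Qed.
Lemma edot0r x : edot x 0 = 0 :> R.
Proof. exact: (linear0 (edotr x)). Qed.
Lemma edotDl x y z : edot (y + z) x = edot y x + edot z x.
Proof. by rewrite edotC edotDr !(edotC x). Qed.
Lemma edotZl a x y : edot (a *: y) x = a * edot y x.
Proof. by rewrite edotC edotZr (edotC x). Qed.
Lemma edotNl x y : edot (- y) x = - edot y x.
Proof. by rewrite edotC edotNr (edotC x). Qed.
Lemma edot0l x : edot 0 x = 0 :> R.
Proof. by rewrite edotC edot0r. Qed.

Definition edotE := (edotDr, edotZr, edotNr, edot0r, edotDl, edotZl, edotNl, edot0l).

Lemma edot_eq0 x : edot x x = 0 -> x = 0.
Proof. by rewrite -normE_edot => /eqP; rewrite sqrf_eq0 normr_eq0 => /eqP. Qed.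

Lemma edot_le_norm x y : edot x y <= `|x| * `|y|.
Proof.
have : `|x + y| ^+ 2 <= (`|x| + `|y|) ^+ 2.
  by rewrite lerXn2r ?nnegrE ?addr_ge0// ler_normD.
by rewrite sqrrD !normE_edot !edotE (edotC y); lra.
Qed.

Lemma norm_edot_le x y : `|edot x y| <= `|x| * `|y|.
Proof.
by rewrite ler_norml edot_le_norm andbT lerNl -edotNr -[`|y|]normrN edot_le_norm.
Qed.

Lemma edot_near z x (e : R) : 0 < e -> \forall y \near x, `|edot z (y - x)| < e.
Proof.
move=> e0; have z1 : 0 < 1 + `|z| by rewrite ltr_pwDl.
apply/nbhs_normP; exists (e / (1 + `|z|)); rewrite /= ?divr_gt0// => y /=.
rewrite distrC ltr_pdivlMr// => xy; apply: le_lt_trans (norm_edot_le _ _) _.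
by apply: le_lt_trans xy; rewrite mulrC ler_wpM2l// lerDr.
Qed.

Lemma edot_closure_ge0 z S y : (forall x, S x -> 0 <= edot z x) ->
  closure S y -> 0 <= edot z y.
Proof.
move=> S0 Sy; rewrite leNgt; apply/negP => zy.
have /Sy[x [/S0 x0]] : nbhs y [set x | `|edot z (x - y)| < - edot z y].
  by apply: edot_near; rewrite oppr_gt0.
by rewrite /= !edotE ltr_norml; lra.
Qed.

Lemma near_line x d (B : set Y) : nbhs x B ->
  exists2 t : R, 0 < t & forall s, `|s| <= t -> B (x + s *: d).
Proof.
move=> /nbhs_normP[e /= e0 eB]; have d1 : 0 < 1 + `|d| by rewrite ltr_pwDl.
exists (e / 2 / (1 + `|d|)) => [|s]; first by rewrite !divr_gt0.
rewrite ler_pdivlMr// => se; apply: eB => /=.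
rewrite opprD addNKr normrN normrZ; have : 0 <= `|s| by [].
by lra.
Qed.

(** Dimension count: [z -> edotr z] is injective, and the space of functionals has the dimension of
    [Y]. *)
Lemma riesz (f : 'Hom(Y, R^o)) : exists z, forall y, f y = edot z y.
Proof.
pose g (z : Y) : 'Hom(Y, R^o) := linfun (edotr z).
have gl : linear g.
  move=> a x y; apply/lfunP => w.
  by rewrite add_lfunE scale_lfunE !lfunE/= /edotr !edotE.
pose gL : {linear Y -> 'Hom(Y, R^o)} := HB.pack g
  (GRing.isLinear.Build R Y 'Hom(Y, R^o) *:%R g gl).
have kg : lker (linfun gL) = 0%VS.
  apply/vspaceP => z; rewrite memv_ker memv0 lfunE/=; apply/eqP/eqP => [gz|->].
    apply: edot_eq0; have := congr1 (fun h : 'Hom(Y, R^o) => h z) gz.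
    by rewrite lfunE/= lfunE.
  by apply/lfunP => w; rewrite !lfunE/= /edotr edot0l.
have : f \in limg (linfun gL).
  suff -> : limg (linfun gL) = fullv by rewrite memvf.
  apply/eqP; rewrite eqEdim subvf/= limg_dim_eq ?kg ?capv0// !dimvf.
  by rewrite {1}/dim/= muln1.
by move=> /memv_imgP[z _ ->]; exists z => y; rewrite lfunE/= lfunE.
Qed.

Lemma perpP S z : perp S z <-> forall x, S x -> edot z x = 0.
Proof.
split=> [Sz x Sx|Sz x]; first by apply: Sz => V; apply.
move=> /(_ (lker (linfun (edotr z)))); rewrite memv_ker lfunE => xz.
by apply/eqP; apply: xz => y /Sz zy; rewrite memv_ker lfunE /= /edotr zy.
Qed.

Lemma perp_perp S x : (forall z, perp S z -> edot z x = 0) -> lin_span S x.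
Proof.
move=> Sx V VS; apply/negPn/negP => /functional_separates[g gV gx].
have [z zE] := riesz g; have Sz : perp S z.
  by apply/perpP => y /VS/gV; rewrite zE.
by have /eqP := Sx z Sz; rewrite -zE gx oner_eq0.
Qed.

Lemma perp_cone S : convex_cone (perp S).
Proof.
split=> [x _|x y Sx Sy z Sz|t x _ Sx z Sz]; first by rewrite edot0l.
- by rewrite edotDl Sx// Sy// addr0.
- by rewrite edotZl Sx// mulr0.
Qed.

Lemma perpN S z : perp S z -> perp S (- z).
Proof. by move=> Sz x /Sz; rewrite edotNl => ->; rewrite oppr0. Qed.

Lemma perpS S S' : S `<=` S' -> perp S' `<=` perp S.
Proof. by move=> SS z /perpP Sz; apply/perpP => x /SS/Sz. Qed.

Lemma cvxP C : convex_set C <-> cvx C.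
Proof.
split=> [cC x y t t0 t1 Cx Cy|cC x y t /set_mem Cx /set_mem Cy]; last first.
  by apply/mem_set; apply: cC.
by have /set_mem := cC x y (Itv01 t0 t1) (mem_set Cx) (mem_set Cy).
Qed.

Lemma closed_convex_coneE K : K !=set0 ->
  closed_convex_cone K <-> closed K /\ convex_cone K.
Proof.
move=> [x Kx]; split=> [[clK /cvxP vK cK]|[clK cK]].
  split=> //; split=> [|y z Ky Kz|t y]; last exact: cK.
    by rewrite -(scale0r x); exact: cK.
  have h : (0:R) <= 2 by [].
  have [h0 h1] : (0:R) <= 2^-1 /\ 2^-1 <= (1:R) by split; lra.
  have := cK 2 _ h (vK _ _ _ h0 h1 Ky Kz); congr K; apply: crdP => i.
  by rewrite !crdE; field.
have [_ _ KZ] := cK; split=> //; by apply/cvxP; apply: convex_cone_cvx.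
Qed.

(** Separating [v] itself would only give a weak inequality. Hence [v] is first moved to [v'],
    slightly towards a core point [r] of [D] but still outside [D]; an inequality at [v'] becomes
    strict at [v]. *)
Lemma closed_cone_separation D v : closed D -> convex_cone D -> ~ D v ->
  exists2 z, dual_cone D z & edot z v < 0.
Proof.
move=> clD cD Dv; have [D0 DD DZ] := cD.
have [r rD] := core_ex (convex_cone_cvx cD) D0; have [Dr _] := rD.
have [B vB BD] : exists2 B, nbhs v B & forall x, B x -> ~ D x.
  apply: contrapT => H; apply: Dv; apply: clD => B vB; apply: contrapT => DB.
  by apply: H; exists B => // x Bx Dx; apply: DB; exists x.
have [e e0 eB] := near_line (r - v) vB.
pose t := Num.min e 2^-1; have t0 : 0 < t by rewrite lt_min e0 invr_gt0/=.
have t1 : t < 1 by rewrite gt_min [X in _ || X](_ : _ = true) ?orbT//; lra.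
have Dv' : ~ D (v + t *: (r - v)).
  by apply: BD; apply: eB; rewrite gtr0_norm// ge_min lexx.
set v' := v + _ in Dv'.
(* The cone generated by [D] and [- v']. It is not a subspace: [v'] in [C] would put [(1 + s) v'],
   hence [v'], in [D]. *)
pose C := [set x | exists2 s : R, 0 <= s & D (x + s *: v')].
have cC : convex_cone C.
  split=> [|x y [s s0 Ds] [u u0 Du]|s x s0 [u u0 Du]].
  - by exists 0 => //; rewrite scale0r addr0.
  - exists (s + u); first exact: addr_ge0.
    by have := DD _ _ Ds Du; congr D; apply: crdP => i; rewrite !crdE; ring.
  - exists (s * u); first exact: mulr_ge0.
    by have := DZ _ _ s0 Du; rewrite scalerDr scalerA.
have DC x : D x -> C x by move=> Dx; exists 0 => //; rewrite scale0r addr0.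
have CNv : C (- v') by exists 1 => //; rewrite scale1r addNr.
have [f [f0 fN0]] : exists f : 'Hom(Y, R^o), (forall x, C x -> 0 <= f x) /\
    ~ (forall x, C x -> f x = 0).
  apply: contrapT => H; have /(_ _)/(_ _ CNv)[] := cone_opp cC.
    by move=> f f0; apply: contrapT => fN0; apply: H; exists f.
  move=> s s0; rewrite opprK -{1}[v']scale1r -scalerDl => Ds.
  apply: Dv'; have s1 : 0 < 1 + s by lra.
  have := DZ (1 + s)^-1 _ _ Ds; rewrite invr_ge0 ltW// => /(_ isT).
  by rewrite scalerA mulVf ?scale1r// gt_eqF.
have [z fz] := riesz f.
have Dz : dual_cone D z by move=> x Dx; rewrite -fz f0//; exact: DC.
exists z => //.
have v'E : edot z v' = (1 - t) * edot z v + t * edot z r.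
  by rewrite /v' !edotE; ring.
have v'0 : edot z v' <= 0 by have := f0 _ CNv; rewrite fz edotNr oppr_ge0.
suff: (1 - t) * edot z v < 0 by rewrite pmulr_rlt0// subr_gt0.
(* If [z] vanishes at the core point [r], it vanishes on [D]; then it cannot vanish at [v'], since
   [f] is not zero on [C]. *)
have [r0|r0] := leP (edot z r) 0; last by have := mulr_gt0 t0 r0; lra.
have {}r0 : edot z r = 0 by apply/eqP; rewrite eq_le r0 Dz.
have zD x : D x -> edot z x = 0.
  rewrite -fz; apply: (core_functional_eq0 cD rD) => [y Dy|]; last by rewrite fz.
  by rewrite fz Dz.
suff z0 : edot z v' != 0.
  by move: v'0 z0; rewrite v'E r0 mulr0 addr0 lt_neqAle => -> ->.
apply/eqP => z0; apply: fN0 => x [s s0 /zD].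
by rewrite fz edotDr edotZr z0 mulr0 addr0.
Qed.

(** * Dual cones and the topological relative interior *)

Lemma dual_cone_cone S : convex_cone (dual_cone S).
Proof.
split=> [x _|x y Sx Sy z Sz|t x t0 Sx z Sz]; first by rewrite edot0l.
- by rewrite edotDl addr_ge0 ?Sx ?Sy.
- by rewrite edotZl mulr_ge0 ?Sx.
Qed.

Lemma dual_cone_closed S : closed (dual_cone S).
Proof.
move=> z Sz x Sx; rewrite edotC; apply: edot_closure_ge0 Sz => y.
by rewrite edotC; apply.
Qed.

Lemma bidual K x : closed K -> convex_cone K -> dual_cone (dual_cone K) x -> K x.
Proof.
move=> clK cK Kx; apply: contrapT => /(closed_cone_separation clK cK)[z Kz].
by rewrite edotC ltNge Kx.
Qed.

(** The sum is the mean of the [n] points [n d_i]; [D 0] covers the case [n = 0]. *)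
Lemma cvx_sum D n (d : 'I_n -> Y) : cvx D -> D 0 ->
  (forall i, D (n%:R *: d i)) -> D (\sum_(i < n) d i).
Proof.
move=> cD D0; elim: n d => [d _|n IH d dD]; first by rewrite big_ord0.
have n1 : 0 < n.+1%:R :> R by rewrite ltr0n.
have := cD _ _ (n%:R / n.+1%:R) _ _
  (IH (fun i => (n.+1%:R / n%:R) *: d (widen_ord (leqnSn n) i)) _) (dD ord_max).
rewrite divr_ge0// ler_pdivrMr// mul1r ler_nat leqnSn => /(_ isT isT).
rewrite big_ord_recr/= -scaler_sumr; case: n => [|n] in IH d dD n1 *.
  rewrite !big_ord0 !mul0r !scale0r subr0 !scale1r; apply => -[] //.
move=> H; have n0 : n.+1%:R != 0 :> R by rewrite pnatr_eq0.
move: H => /(_ _); set T := \sum_(i < n.+1) _; set w := d ord_max => H.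
have {}H := H _.
suff -> : T + w = (n.+1%:R / n.+2%:R) *: ((n.+2%:R / n.+1%:R) *: T) +
    (1 - n.+1%:R / n.+2%:R) *: (n.+2%:R *: w).
  by apply: H => i; rewrite scalerA mulrCA mulfV// mulr1; exact: dD.
apply: crdP => i; rewrite !crdE; move: n0 n1; rewrite -[n.+2%:R]natr1.
by move: (n.+1%:R : R) => a a0 a1; field; rewrite a0 gt_eqF.
Qed.

(** From left to right, [x + t (x - y)] stays in the affine hull and is close to [x]. Conversely,
    [C] contains a symmetric interval around [x] along each of finitely many spanning directions; a
    point near [x] has small coordinates, and is the mean of points of these intervals. *)
Lemma relint_core C x : cvx C -> relint C x <-> core C x.
Proof.
move=> cC; split=> [[Cx nx]|xC].
  split=> // y Cy; have [t t0 tC] := near_line (x - y) nx.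
  exists t => //; apply: tC; first by rewrite gtr0_norm.
  move=> p V CV; have -> : x + t *: (x - y) - p = (1 + t) *: (x - p) - t *: (y - p).
    by apply: crdP => i; rewrite !crdE; ring.
  by rewrite rpredB// rpredZ// CV.
have [Cx _] := xC; split=> //; have [e Ce eC] := core_span cC xC.
pose n := size e; pose X := in_tuple e.
have tP (i : 'I_n) : exists2 t : R, 0 < t & forall s, `|s| <= t -> C (x + s *: X`_i).
  have Xe : X`_i \in <<e>>%VS by rewrite memv_span// mem_nth.
  have [t t0 Ct] := eC _ Xe.
  have [u u0 Cu] := eC (- X`_i) (etrans (memvN _ _) Xe).
  exists (Num.min t u); first by rewrite lt_min t0.
  move=> s; rewrite le_min => /andP[st su].
  have := cC _ _ ((s + u) / (t + u)) _ _ Ct Cu.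
  have tu0 : 0 < t + u by rewrite addr_gt0.
  have su0 : 0 <= s + u by move: su; rewrite ler_norml => /andP[? ?]; lra.
  rewrite divr_ge0 ?ler_pdivrMr ?mul1r ?(ltW tu0)//.
  rewrite lerD2r (le_trans (ler_norm _) st) => /(_ isT isT).
  congr C; apply: crdP => j; rewrite !crdE; field; by rewrite gt_eqF.
have : \forall y \near x, forall i : 'I_n,
    C (x + (n%:R * coord X i (y - x)) *: X`_i).
  apply: filter_forall => i; have [t t0 tC] := tP i.
  (* Coordinates are inner products, hence continuous. *)
  have [z zE] := riesz (linfun (coord X i : Y -> R^o)).
  apply: filterS (edot_near (n%:R *: z) x t0) => y.
  by rewrite edotZl -zE lfunE/= => /ltW; exact: tC.
apply: filterS => y Cy /(_ x <<e>>%VS Ce) /(@coord_span _ _ _ X) yE.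
rewrite -(subrK x y) addrC yE.
apply: (cvx_sum (D := [set d | C (x + d)])) => [u v t t0 t1 Cu Cv||i].
- have := cC _ _ _ t0 t1 Cu Cv; congr C; apply: crdP => j; rewrite !crdE; ring.
- by rewrite /= addr0.
- by rewrite scalerA; exact: Cy.
Qed.

End EuclideanFacts.

(** * Exposed faces and nice cones *)

Section ExposedFaces.
Variables (R : realType) (Y : euclideanType R).
Implicit Types (x y z u v : Y) (K F : set Y).

Definition exposed_face K u : set Y := [set x | K x /\ edot u x = 0].

Lemma exposed_face0 K : exposed_face K 0 = K.
Proof. by apply/seteqP; split=> [x []//|x Kx]; split=> //; rewrite edot0l. Qed.

Lemma exposed_face_cone K u : convex_cone K -> convex_cone (exposed_face K u).
Proof.
move=> [K0 KD KZ]; split=> [|x y [Kx ux] [Ky uy]|t x t0 [Kx ux]].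
- by split=> //; rewrite edot0r.
- by split; [exact: KD|rewrite edotDr ux uy addr0].
- by split; [exact: KZ|rewrite edotZr ux mulr0].
Qed.

(** Both terms are nonnegative on [K], so the sum vanishes only where both do. Adding dual vectors
    thus intersects faces. *)
Lemma exposed_faceD K u u' : dual_cone K u -> dual_cone K u' ->
  exposed_face K (u + u') = exposed_face K u `&` exposed_face K u'.
Proof.
move=> Ku Ku'; apply/seteqP; split=> x; last first.
  by move=> [[Kx ux] [_ u'x]]; split=> //; rewrite edotDl ux u'x addr0.
move=> [Kx]; rewrite edotDl => /eqP.
by rewrite paddr_eq0 ?Ku ?Ku'// => /andP[/eqP ? /eqP ?].
Qed.

Lemma exposed_face_face K u : convex_cone K -> dual_cone K u ->
  face K (exposed_face K u).
Proof.
move=> cK Ku; split=> [x []//||x y Kx Ky].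
  by apply/cvxP; apply: convex_cone_cvx; exact: exposed_face_cone.
move=> [_ [[t [t0 t1 ->]] [_ /eqP]]].
have {}t1 : 0 < 1 - t by rewrite subr_gt0.
rewrite edotDr !edotZr paddr_eq0 ?mulr_ge0 ?Ku ?(ltW t0) ?(ltW t1)//.
by rewrite !mulf_eq0 (gt_eqF t0) (gt_eqF t1)/= => /andP[/eqP ? /eqP ?].
Qed.

Lemma closure_cone (C : set Y) : convex_cone C -> convex_cone (closure C).
Proof.
move=> [C0 CD CZ]; split; first exact: subset_closure.
- move=> x y Cx Cy B /nbhs_normP[e /= e0 eB].
  have e2 : 0 < e / 2 by rewrite divr_gt0.
  have [x' [Cx' xx']] := Cx _ (nbhsx_ballx x _ e2).
  have [y' [Cy' yy']] := Cy _ (nbhsx_ballx y _ e2).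
  exists (x' + y'); split; first exact: CD.
  move: xx' yy'; rewrite -!ball_normE/= => xx' yy'; apply: eB => /=.
  rewrite opprD addrACA; apply: le_lt_trans (ler_normD _ _) _.
  by rewrite [e]splitr ltrD.
- move=> t x; rewrite le_eqVlt => /predU1P[<- _|t0 Cx B].
    by rewrite scale0r; apply: subset_closure.
  move=> /nbhs_normP[e /= e0 eB].
  have [x' [Cx' xx']] := Cx _ (nbhsx_ballx x _ (divr_gt0 e0 t0)).
  exists (t *: x'); split; first by apply: CZ; rewrite ?ltW.
  move: xx'; rewrite -!ball_normE/= => xx'; apply: eB => /=.
  by rewrite -scalerBr normrZ gtr0_norm// mulrC -ltr_pdivlMr.
Qed.

(** On the exposed face, feasible directions are nonnegative, so tangent vectors, being limits with
    both signs, vanish there. Conversely, a vector separating [w] from the feasible directions lies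
    in the face, where [w] is zero. *)
Lemma tangent_spaceP K u v : closed K -> convex_cone K -> dual_cone K u ->
  tangent_space u (dual_cone K) v <-> perp (exposed_face K u) v.
Proof.
move=> clK cK Ku; split=> [[uv uNv]|].
  have dir_ge0 x : exposed_face K u x -> forall y,
      feas_dir u (dual_cone K) y -> 0 <= edot x y.
    move=> [Kx ux] y [t t0 /(_ x Kx)]; rewrite edotDl ux add0r edotZl.
    by rewrite pmulr_rge0// edotC.
  apply/perpP => x ux; rewrite edotC; apply/eqP; rewrite eq_le.
  rewrite (edot_closure_ge0 (dir_ge0 _ ux) uv) andbT -oppr_ge0 -edotNr.
  exact: edot_closure_ge0 (dir_ge0 _ ux) uNv.
have cKd := dual_cone_cone K; have [_ DD DZ] := cKd.
suff H w : perp (exposed_face K u) w -> closure (feas_dir u (dual_cone K)) w.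
  by move=> uv; split; apply: H; rewrite //; exact: perpN.
move=> /perpP uw; apply: contrapT => wN.
have ccl := closure_cone (dirs_cone (convex_cone_cvx cKd) Ku).
have [z zD zw] := closed_cone_separation (@closed_closure _ _) ccl wN.
have dz y : feas_dir u (dual_cone K) y -> 0 <= edot z y.
  by move=> uy; apply: zD; exact: subset_closure.
(* All of the dual cone consists of feasible directions at [u], whence [K z]; so is [- u], whence
   [edot u z = 0]. *)
have Kz : K z.
  apply: (bidual clK cK) => y Ky; apply: dz; exists 1 => //.
  by rewrite scale1r; exact: DD.
have uz : edot u z = 0.
  apply/eqP; rewrite eq_le [X in _ && X]Ku// andbT -oppr_ge0 edotC -edotNr.
  apply: dz; exists 1; first by [].
  by rewrite scale1r subrr => x _; rewrite edot0l.
by move: zw; rewrite edotC uw// ltxx.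
Qed.

(** Niceness makes [D] closed. A vector [z] separating [y] from [D] is in [K] by biduality and in
    the span of the face, hence in the face itself, where [y] is nonnegative. *)
Lemma nice_cone_decomposition K u y : nice_cone K -> convex_cone K ->
  dual_cone K u -> dual_cone (exposed_face K u) y ->
  exists k e, [/\ dual_cone K k, perp (exposed_face K u) e & y = k + e].
Proof.
move=> [[clK _ _] nK] cK Ku Fy.
set D := [set k + e | k in dual_cone K & e in perp (exposed_face K u)].
suff [k Kk [e Fe <-]] : D y by exists k, e.
have [k0 kD kZ] := dual_cone_cone K.
have [e0 eD eZ] := perp_cone (exposed_face K u).
have cD : convex_cone D.
  split; first by exists 0 => //; exists 0 => //; rewrite addr0.
  - move=> _ _ [k Kk [e Fe <-]] [k' Kk' [e' Fe' <-]].
    exists (k + k'); first exact: kD.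
    by exists (e + e'); [exact: eD|rewrite addrACA].
  - move=> t _ t0 [k Kk [e Fe <-]]; exists (t *: k); first exact: kZ.
    by exists (t *: e); [exact: eZ|rewrite scalerDr].
apply: contrapT => Dy.
have clD := nK _ (exposed_face_face cK Ku).
have [z zD zy] := closed_cone_separation clD cD Dy.
have Kz : K z.
  apply: (bidual clK cK) => k Kk; apply: zD.
  by exists k => //; exists 0 => //; rewrite addr0.
have Fz : lin_span (exposed_face K u) z.
  have zp e : perp (exposed_face K u) e -> 0 <= edot e z.
    by move=> Fe; rewrite edotC; apply: zD; exists 0 => //; exists e; rewrite ?add0r.
  apply: perp_perp => e Fe; apply/eqP; rewrite eq_le zp// andbT -oppr_ge0 -edotNl.
  exact/zp/perpN.
have uz : edot u z = 0.
  have := Fz (lker (linfun (edotr u))); rewrite memv_ker lfunE/= => H.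
  by apply/eqP/H => x [_ ux]; rewrite memv_ker lfunE/= /edotr ux.
by move: zy; rewrite edotC ltNge Fy.
Qed.

(** * Core points of faces and chains of faces *)

Lemma core_cone_comb F r x (a : R) : convex_cone F -> core F r -> F x -> 0 < a ->
  core F (a *: r + x).
Proof.
move=> cF rF Fx a0; have [_ FD FZ] := cF; have [Fr _] := rF.
have a1 : 0 < `|a - 1| + 1 by rewrite ltr_wpDl.
(* This [t] is small enough to keep the coefficient [a + t (a - 1)] of [r] nonnegative. *)
apply: (core_between (t := a / (`|a - 1| + 1))) (rF) _ _ _.
- exact: convex_cone_cvx.
- by apply: FD => //; apply: FZ; rewrite // ltW.
- by rewrite divr_gt0.
set t := a / _; have t0 : 0 < t by rewrite divr_gt0.
have ta : t * (`|a - 1| + 1) = a by rewrite mulfVK// gt_eqF.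
have -> : a *: r + x + t *: (a *: r + x - r) = (a + t * (a - 1)) *: r + (1 + t) *: x.
  by apply: crdP => i; rewrite !crdE; ring.
apply: FD; apply: FZ => //; last by lra.
have : t * - (a - 1) <= t * `|a - 1| by rewrite ler_pM2l// -normrN ler_norm.
by rewrite -[X in _ <= X + _]ta; lra.
Qed.

(** For [x] in [F], the common point [r] lies strictly between [x] and [r + t (r - x)], so the face
    [G] contains [x]; the roles are symmetric. *)
Lemma face_eq_core K F G r : face K F -> face K G -> core F r -> core G r -> F = G.
Proof.
move=> + + rF rG; wlog suff H : F G rF rG / face K F -> face K G -> F `<=` G.
  by move=> KF KG; apply/seteqP; split; exact: H.
move=> [FK _ _] [_ _ GK] x Fx; have [_ Dr] := rF.
have [t t0 Ft] := Dr x Fx; have [Gr _] := rG.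
have [] // := GK _ _ (FK _ Fx) (FK _ Ft).
have t1 : 0 < 1 + t by lra.
exists r; split=> //; exists (1 + t)^-1.
rewrite invr_gt0 invf_lt1//; split=> //; first by lra.
by apply: crdP => i; rewrite !crdE; field; rewrite gt_eqF.
Qed.

Lemma face0 K F : convex_cone K -> face K F -> F !=set0 -> F 0.
Proof.
move=> [K0 _ KZ] [FK _ KF] [x Fx].
have [] // := KF 0 (2 *: x) K0 (KZ _ _ _ (FK _ Fx)) => //.
exists x; split=> //; exists 2^-1; split; [lra|lra|].
by apply: crdP => i; rewrite !crdE; field.
Qed.

(** At a core point [r] of [F] the direction [- x] is feasible, and [r / (1 + t)], a point of [F],
    lies strictly between [x] and [r - t x]. *)
Lemma face_span K F (e : seq Y) x : convex_cone K -> face K F -> F !=set0 ->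
  (forall y, y \in e -> F y) -> K x -> x \in <<e>>%VS -> F x.
Proof.
move=> cK KF F0 eF Kx xe; have F_0 := face0 cK KF F0.
have [FK /cvxP cF KFs] := KF.
have [r rF] := core_ex cF F_0; have [Fr _] := rF.
have [e' Fe' e'F] := core_span cF rF.
have re' : r \in <<e'>>%VS by have := Fe' _ F_0; rewrite sub0r memvN.
have : - x \in <<e'>>%VS.
  rewrite memvN; apply: subvP xe; apply/span_subvP => y /eF/Fe' ye.
  by rewrite -(subrK r y) rpredD.
move=> /e'F[t t0 Ft].
have [] // := KFs _ _ Kx (FK _ Ft).
have t1 : 0 < 1 + t by lra.
exists ((1 + t)^-1 *: r); split; last first.
  have := cF _ _ (1 + t)^-1 _ _ Fr F_0; rewrite scaler0 addr0; apply.
    by rewrite invr_ge0 ltW.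
  by rewrite invf_le1//; lra.
exists (1 + t)^-1; rewrite invr_gt0 invf_lt1//; split=> //; first by lra.
by apply: crdP => i; rewrite !crdE; field; rewrite gt_eqF.
Qed.

(** By [face_span], a strict inclusion of faces raises the dimension of the span. *)
Lemma face_chain_le K k (F : 'I_k -> set Y) : convex_cone K -> face_chain K F ->
  (k <= (\dim {:Y}).+1)%N.
Proof.
move=> cK [FK Flt]; have [E EF] := choice (fun i => span_set (F i)).
suff H (i : 'I_k) : (i <= \dim <<E i>>)%N.
  case: k => // k in F FK Flt E EF H *.
  by rewrite ltnS (leq_trans (H ord_max))// dimvS// subvf.
case: i => i; elim: i => // i IH lti; have lti' := ltnW lti.
apply: leq_ltn_trans (IH lti') _; set i0 := Ordinal lti'; set i1 := Ordinal lti.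
have [EF0 F0E] := EF i0; have [EF1 F1E] := EF i1.
have [F01 F10] : F i0 `<` F i1 by apply: Flt => /=.
rewrite ltnNge; apply/negP => le10; apply: F10 => x F1x.
have sub01 : (<<E i0>> <= <<E i1>>)%VS.
  by apply/span_subvP => y /EF0/F01/F1E.
have E01 : <<E i0>>%VS = <<E i1>>%VS by apply/eqP; rewrite eqEdim sub01.
have [[F0K F0n] [[F1K _ _] _]] := (FK i0, FK i1).
by apply: (face_span cK F0K F0n EF0); rewrite ?E01; [exact: F1K|exact: F1E].
Qed.

(** The dimension bound ensures that the supremum is not the default value 0. *)
Lemma face_chain_longest K k (F : 'I_k -> set Y) : convex_cone K ->
  face_chain K F -> (k <= longest_face_chain K)%N.
Proof.
move=> cK KF; rewrite -leEnat; apply: ge_supremum_Nmem; last by exists F.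
apply: nat_supremums_neq0; exists (\dim {:Y}).+1 => n [G KG].
exact: face_chain_le cK KG.
Qed.

End ExposedFaces.

(** * Strong duality under a Slater condition *)

Section ConicProgram.
Variables (R : realType) (X Y : euclideanType R) (A : 'Hom(X, Y)) (b : Y).
Implicit Types (K F G : set Y) (x : X) (y z s : Y).

(** Riesz representation gives the adjoint pointwise and uniqueness makes it linear, so [xget] does
    not fall back on its default. *)
Lemma adjointP x y : edot (A x) y = edot x (adjoint A y).
Proof.
rewrite /adjoint; move: x y; apply: (@xgetPex _ 0 [set B : 'Hom(Y, X) |
  forall x y, edot (A x) y = edot x (B y)]).
have [B BE] : exists B : Y -> X, forall y x, edot (A x) y = edot x (B y).
  suff /choice[B BE] : forall y, exists z : X, forall x, edot (A x) y = edot x z by exists B.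
  move=> y; have [z zE] := riesz (linfun (edotr y) \o A)%VF.
  by exists z => x; rewrite (edotC x) -zE comp_lfunE lfunE/= /edotr edotC.
have Bl : linear B.
  move=> a y z; apply/eqP; rewrite -subr_eq0; apply/eqP/edot_eq0.
  by set w := (X in edot X _); rewrite edotDr edotNr edotDr edotZr -!BE !edotE subrr.
pose BL : {linear Y -> X} := HB.pack B
  (GRing.isLinear.Build R Y X *:%R B Bl).
by exists (linfun BL) => x y; rewrite lfunE/= BE.
Qed.

Lemma annihilatorP y : reflect (adjoint A y = 0 /\ edot b y = 0)
  (y \in annihilator A b).
Proof.
by rewrite mem_annihilator; apply: (iffP andP) => -[/eqP ? /eqP ?].
Qed.

Lemma annihilator_slack y x : y \in annihilator A b -> edot y (b - A x) = 0.
Proof.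
move=> /annihilatorP[Ay by0].
by rewrite edotC edotDl edotNl by0 adjointP Ay edot0r subr0.
Qed.

(** A functional nonnegative on [C], the sum of [F] and the span of [b] and the range of [A], is
    represented by a dual vector of [F] in the annihilator, hence is zero on [C]. So [C] is a
    subspace and contains [- r0] for a core point [r0] of [F]. *)
Lemma slater_alternative F x0 : convex_cone F -> F (b - A x0) ->
  (forall y, dual_cone F y -> y \in annihilator A b -> perp F y) ->
  exists x, core F (b - A x).
Proof.
move=> cF Fx0 Fy; have [F0 FD FZ] := cF.
pose C := [set y | exists x (t : R), F (y + (t *: b - A x))].
have cC : convex_cone C.
  split; first by exists 0, 0; rewrite add0r linear0 scale0r subr0.
  - move=> y z [x [t Fx]] [w [u Fw]]; exists (x + w), (t + u).
    by have := FD _ _ Fx Fw; congr F; rewrite [A (_ + _)]linearD; apply: crdP => i; rewrite !crdE; ring.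
  - move=> a y a0 [x [t Fx]]; exists (a *: x), (a * t).
    by have := FZ _ _ a0 Fx; congr F; rewrite [A (_ *: _)]linearZ/=; apply: crdP => i; rewrite !crdE; ring.
have [r0 r0F] := core_ex (convex_cone_cvx cF) F0; have [Fr0 _] := r0F.
have Cr0 : C r0 by exists 0, 0; rewrite scale0r linear0 subr0 addr0.
have [x [t Fx]] : C (- r0).
  apply: cone_opp Cr0 => // f f0 y [x [t Fx]]; have [z zE] := riesz f.
  have CN (w : X) (u : R) : C (u *: b - A w).
    by exists (- w), (- u); have := F0; congr F; rewrite linearN; apply: crdP => i; rewrite !crdE; ring.
  have zN x' (u : R) : edot z (u *: b - A x') = 0.
    apply/eqP; rewrite eq_le -{2}zE f0// andbT -oppr_ge0 -edotNr -zE f0//.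
    have -> : - (u *: b - A x') = (- u) *: b - A (- x').
      by rewrite linearN scaleNr opprK opprB addrC.
    exact: CN.
  have /perpP zF : perp F z.
    apply: Fy; first by move=> s Fs; rewrite -zE f0//; exists 0, 0; rewrite scale0r linear0 subr0 addr0.
    apply/annihilatorP; split; last by have := zN 0 1; rewrite linear0 subr0 scale1r edotC.
    apply: edot_eq0; rewrite -adjointP edotC.
    by have := zN (adjoint A z) 0; rewrite scale0r sub0r edotNr => /eqP; rewrite oppr_eq0 => /eqP.
  by have := zF _ Fx; rewrite edotDr zN addr0 zE.
(* The coefficient [t] of [b] may be negative; adding [|t| + 1] times the slack of [x0] makes it
   positive, and dividing by it gives a slack. *)
pose a := (t + (`|t| + 1)); have a0 : 0 < a.
  by have := ler_norm (- t); rewrite normrN /a; lra.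
exists (a^-1 *: (x + (`|t| + 1) *: x0)).
have -> : b - A (a^-1 *: (x + (`|t| + 1) *: x0)) =
    a^-1 *: r0 + a^-1 *: ((- r0 + (t *: b - A x)) + (`|t| + 1) *: (b - A x0)).
  rewrite !(linearD, linearZ)/=; apply: crdP => i; rewrite !crdE.
  have aE : `|t| + 1 = a - t by rewrite /a; ring.
  by rewrite !aE; field; rewrite gt_eqF.
apply: core_cone_comb => //; last by rewrite invr_gt0.
apply: (FZ); first by rewrite invr_ge0 ltW.
by apply: FD => //; apply: FZ; rewrite ?addr_ge0.
Qed.

(** A relative interior solution prolongs the segment from [x0] within the feasible set, so its
    slack is a core point of [G]. The face chosen by [xget] shares this core point, hence equals
    [G]. *)
Lemma minimal_coneE K G x0 : cvx K -> face K G ->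
  (forall x, K (b - A x) -> G (b - A x)) -> core G (b - A x0) ->
  minimal_cone A b K = G.
Proof.
move=> cK KG feasG Gx0; have [_ /cvxP cG _] := KG; have [GK _ _] := KG.
have cP : cvx (feasible A b K).
  move=> x y t t0 t1 Kx Ky; rewrite /feasible/=.
  have := cK _ _ _ t0 t1 Kx Ky; congr K; rewrite [A (_ + _)]linearD/= ![A (_ *: _)]linearZ/=.
  by apply: crdP => i; rewrite !crdE; ring.
have GP : [set F | face K F /\
    forall x, relint (feasible A b K) x -> relint F (b - A x)] G.
  split=> // x /(relint_core _ cP)[Kx Dx]; apply/relint_core => //.
  have Kx0 : feasible A b K x0 by have [/GK] := Gx0.
  have [t t0 Kt] := Dx _ Kx0; apply: (core_between (t := t) cG Gx0) => //.
    exact: feasG.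
  have := feasG _ Kt; congr G; rewrite [A (_ + _)]linearD/= [A (_ *: _)]linearZ/= [A (_ - _)]linearB/=.
  by apply: crdP => i; rewrite !crdE; ring.
have [KF FP] := @xgetPex _ set0 _ (ex_intro _ _ GP).
have [x xP] : exists x, core (feasible A b K) x.
  by apply: (core_ex cP (p := x0)); exact: (GK _ Gx0.1).
have xF := FP x ((relint_core _ cP).2 xP).
have xG := GP.2 x ((relint_core _ cP).2 xP).
have [_ /cvxP cF _] := KF.
by apply: (face_eq_core KF KG (r := b - A x)); exact/relint_core.
Qed.

Section Duality.
Variables (c : X) (K G : set Y) (x0 : X).
Hypotheses (cG : convex_cone G) (GK : G `<=` K).
Hypotheses (feasG : forall x, K (b - A x) -> G (b - A x)).
Hypothesis slater : core G (b - A x0).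

(** The system is homogenized in [Y * R^o]: [hom] says that [(0, -1)] is not in the cone [C], so
    some functional [(z, tau)] is nonnegative and not zero on [C]; the multiplier is [z / tau]. *)
Lemma slater_multiplier (p : R) : (forall x, K (b - A x) -> edot c x <= p) ->
  exists z, [/\ dual_cone G z, adjoint A z = c & edot b z <= p].
Proof.
move=> xp; have [G0 GD GZ] := cG; have [Gx0 _] := slater.
(* For [t = 0], a recession direction [x] with positive objective would, followed far enough from
   [x0], push the objective above [p]. *)
have hom x (t : R) : 0 <= t -> G (t *: b - A x) -> edot c x <= t * p.
  rewrite le_eqVlt => /predU1P[<-|t0] Gx; last first.
    rewrite -ler_pdivrMl// -edotZr; apply/xp/GK.
    have := GZ t^-1 _ _ Gx; rewrite invr_ge0 ltW// => /(_ isT); congr G.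
    by rewrite [A (_ *: _)]linearZ/=; apply: crdP => i; rewrite !crdE; field; rewrite gt_eqF.
  rewrite mul0r leNgt; apply/negP => cx.
  have := xp (x0 + (`|p - edot c x0| + 1) / edot c x *: x).
  have /[swap]/[apply] : K (b - A (x0 + (`|p - edot c x0| + 1) / edot c x *: x)).
    set a := _ / _; have a0 : 0 <= a by rewrite divr_ge0 ?ltW// ltr_wpDl.
    apply: GK; have := GD _ _ Gx0 (GZ _ _ a0 Gx); congr G.
    by rewrite [A (_ + _)]linearD/= [A (_ *: _)]linearZ/=; apply: crdP => i; rewrite !crdE; ring.
  rewrite edotDr edotZr mulfVK ?gt_eqF//.
  by have := ler_norm (p - edot c x0); lra.
pose V := (Y * R^o)%type.
pose C : set V := [set w | exists x (t r : R), [/\ 0 <= t, 0 <= r,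
  G (w.1 + (t *: b - A x)) & w.2 = t * p - edot c x + r]].
have cC : convex_cone C.
  split.
  - exists 0, 0, 0; split; rewrite //= ?[A 0]linear0 ?scale0r ?subrr ?addr0//.
    by rewrite edot0r mul0r subrr.
  - move=> w w' [x [t [r [t0 r0 Gw wE]]]] [x' [t' [r' [t'0 r'0 Gw' w'E]]]].
    exists (x + x'), (t + t'), (r + r'); split; rewrite ?addr_ge0//.
      by have := GD _ _ Gw Gw'; congr G; rewrite [A (_ + _)]linearD; apply: crdP => i; rewrite !crdE; ring.
    by rewrite edotDr -[(w + w').2]/(w.2 + w'.2 : R) wE w'E; ring.
  - move=> a w a0 [x [t [r [t0 r0 Gw wE]]]].
    exists (a *: x), (a * t), (a * r); split; rewrite ?mulr_ge0//.
      by have := GZ _ _ a0 Gw; congr G; rewrite [A (_ *: _)]linearZ/=; apply: crdP => i; rewrite !crdE; ring.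
    by rewrite edotZr -[(a *: w).2]/(a * w.2 : R) wE; ring.
have C01 : C (0, 1).
  exists 0, 0, 1; split; rewrite //= ?scale0r ?linear0 ?subr0 ?addr0//.
  by rewrite edot0r mul0r subr0 add0r.
have [f [f0 fN0]] : exists f : 'Hom(V, R^o), (forall w, C w -> 0 <= f w) /\
    ~ (forall w, C w -> f w = 0).
  apply: contrapT => H; have /(_ _)/(_ _ C01)[] := cone_opp cC.
    by move=> f f0; apply: contrapT => fN0; apply: H; exists f.
  move=> x [t [r [t0 r0 /= Gx]]]; rewrite oppr0 add0r in Gx.
  by have := hom _ _ t0 Gx; lra.
pose i1 (y : Y) : V := (y, 0).
have i1l : linear i1.
  by move=> a y z; congr pair; rewrite /= scaler0 addr0.
pose i1L : {linear Y -> V} := HB.pack i1 (GRing.isLinear.Build R Y V *:%R i1 i1l).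
have [z zE] := riesz (f \o linfun i1L)%VF.
have {}zE y : f (y, 0) = edot z y by rewrite -zE comp_lfunE lfunE.
pose tau : R := f (0, 1).
have fE w : f w = edot z w.1 + tau * w.2.
  have wE : w = (w.1, 0) + w.2 *: ((0, 1) : V).
    case: w => y a; congr pair; first by rewrite /= scaler0 addr0.
    by rewrite /= add0r [RHS]mulr1.
  by rewrite {1}wE linearD linearZ/= zE -/tau [_ *: _]mulrC.
have tau0 : 0 <= tau by exact: f0.
have zG y : G y -> 0 <= edot z y.
  move=> Gy; have := f0 (y, 0); rewrite zE; apply.
  exists 0, 0, 0; split; rewrite //= ?[A 0]linear0 ?scale0r ?subrr ?addr0//.
  by rewrite edot0r mul0r subrr.
have CN x (t : R) : 0 <= t -> C (- (t *: b - A x), t * p - edot c x).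
  by move=> t0; exists x, t, 0; split; rewrite //= ?addNr ?addr0.
have zA x : edot z (A x) = tau * edot c x.
  have h w : 0 <= edot z (A w) - tau * edot c w.
    have := f0 _ (CN w 0 (lexx _)); rewrite fE/= scale0r sub0r opprK mul0r sub0r.
    by rewrite mulrN.
  have := h (- x); have := h x; rewrite linearN !edotNr; lra.
have zb : edot z b <= tau * p.
  have := f0 _ (CN 0 1 ler01); rewrite fE/= linear0 subr0 scale1r edot0r subr0.
  by rewrite edotNr mul1r; lra.
(* If [tau = 0], then [z] vanishes on the range of [A] and at [b], hence at the Slater point, hence
   on [G], and the functional is zero on [C]. *)
have {tau0} tau0 : 0 < tau.
  rewrite lt_neqAle tau0 andbT eq_sym; apply/eqP => {}tau0.
  apply: fN0 => w [x [t [r [t0 _ Gw _]]]]; rewrite fE tau0 mul0r addr0.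
  rewrite tau0 mul0r in zb.
  have zA0 u : edot z (A u) = 0 by rewrite zA tau0 mul0r.
  have zb0 : edot z b = 0.
    by apply/eqP; rewrite eq_le zb/=; have := zG _ Gx0; rewrite edotDr edotNr zA0 subr0.
  have z0 y : G y -> edot z y = 0.
    have eqz u : linfun (edotr z) u = edot z u by rewrite lfunE.
    move=> Gy; rewrite -eqz; apply: (core_functional_eq0 cG slater) Gy => [u Gu|].
      by rewrite eqz zG.
    by rewrite eqz edotDr edotNr zA0 zb0 subr0.
  by have := z0 _ Gw; rewrite !edotDr edotNr edotZr zA0 zb0 mulr0 subr0 addr0.
exists (tau^-1 *: z); split.
- by move=> y Gy; rewrite edotZl mulr_ge0 ?zG// invr_ge0 ltW.
- apply/eqP; rewrite -subr_eq0; apply/eqP/edot_eq0; set w := (X in edot X _).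
  rewrite edotDr edotNr -adjointP edotZr (edotC _ z) zA mulKf ?gt_eqF//.
  by rewrite (edotC w) subrr.
- by rewrite edotZr edotC ler_pdivrMl.
Qed.

(** With the primal value as [p], the multiplier attains it by weak duality. Conversely a dual
    solution bounds the primal value above, and [x0] bounds it below. *)
Lemma slater_strong_duality : strong_duality (feasible A b K) (edot c)
  [set z | dual_cone G z /\ adjoint A z = c] (edot b).
Proof.
rewrite /strong_duality/=; set D := [set z | _]; set vP := ereal_sup _; set vD := ereal_inf _.
have weak x z : feasible A b K x -> D z -> edot c x <= edot b z.
  move=> Kx [Gz <-]; have := Gz _ (feasG Kx).
  by rewrite edotDr edotNr (edotC z b) (edotC z) adjointP (edotC x) subr_ge0.
have Kx0 : feasible A b K x0 by have [/GK] := slater.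
have weakE : (vP <= vD)%E.
  apply: ge_ereal_sup => _ [x Kx <-]; apply: le_ereal_inf_tmp => _ [z Dz <-].
  by rewrite lee_fin weak.
have x0P : ((edot c x0)%:E <= vP)%E by apply: ereal_sup_ubound; exists x0.
have attained : vP \is a fin_num -> vP = vD /\ exists2 z, D z & (edot b z)%:E = vD.
  move=> fP; have xp x : K (b - A x) -> edot c x <= fine vP.
    by move=> Kx; rewrite -lee_fin fineK//; apply: ereal_sup_ubound; exists x.
  have [z [Gz Az bz]] := slater_multiplier xp.
  have Dz : D z by split.
  have zD : (vD <= (edot b z)%:E)%E by apply: ereal_inf_lbound; exists z.
  have zP : ((edot b z)%:E <= vP)%E by rewrite -(fineK fP) lee_fin.
  have PD : vP = vD by apply/eqP; rewrite eq_le weakE (le_trans zD zP).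
  by split=> //; exists z => //; apply/eqP; rewrite eq_le zD -PD zP.
split=> //; split=> [/attained[_ [z Dz _]]|[z Dz]]; first by exists z.
have zD : (vD <= (edot b z)%:E)%E by apply: ereal_inf_lbound; exists z.
by rewrite fin_real// (lt_le_trans _ x0P) ?ltNyr// (le_lt_trans weakE)// (le_lt_trans zD)// ltry.
Qed.

End Duality.

End ConicProgram.

(** Strong duality depends on the dual problem only through its set of objective values, so the dual
    variables may be changed. *)
Lemma strong_duality_image (R : realType) (T T1 T2 : Type) (P : set T) (f : T -> R)
    (D1 : set T1) (g1 : T1 -> R) (D2 : set T2) (g2 : T2 -> R) :
  [set g1 z | z in D1] = [set g2 z | z in D2] ->
  strong_duality P f D1 g1 -> strong_duality P f D2 g2.
Proof.
move=> E; have EE : [set (g1 z)%:E | z in D1] = [set (g2 z)%:E | z in D2].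
  by rewrite -[LHS](image_comp g1 (@EFin R)) E image_comp.
have val2 z : D1 z -> exists2 w, D2 w & g2 w = g1 z.
  by move=> Dz; have : [set g1 z | z in D1] (g1 z) by [exists z]; rewrite E.
rewrite /strong_duality EE => -[[finD Dfin] att]; split.
  split=> [/finD[z /val2[w Dw _]]|[w Dw]]; first by exists w.
  have : [set g2 z | z in D2] (g2 w) by exists w.
  by rewrite -E => -[z Dz _]; apply: Dfin; exists z.
move=> /att[-> [z /val2[w Dw wz] zE]]; split=> //.
by exists w => //; rewrite wz.
Qed.

(** * Facial reduction *)

Section FacialReduction.
Variables (R : realType) (X Y : euclideanType R) (A : 'Hom(X, Y)) (b : Y).
Implicit Types (K F G : set Y) (x : X) (y z s : Y) (L : {vspace Y}).
Implicit Types u v : nat -> Y.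

(* The constraints of the extended dual, with [perp (exposed_face K u)] in place
   of the equal space [tangent_space u (dual_cone K)]. *)
Definition reduction K L l u v := [/\ u 0%N = 0, v 0%N = 0,
  forall i, (i <= l)%N ->
    dual_cone K (u i.+1) /\ perp (exposed_face K (u i)) (v i.+1) &
  forall i, (i < l)%N -> u i.+1 + v i.+1 \in L].

(** The faces of [u_0, ..., u_k] form the chain; the pair of index [k + 1] is the free last pair of
    [reduction]. *)
Definition strict_reduction K L k u v := reduction K L k u v /\
  forall i, (i < k)%N -> exposed_face K (u i.+1) `<` exposed_face K (u i).

Lemma reduction_dual K L l u v i : reduction K L l u v -> (i <= l.+1)%N ->
  dual_cone K (u i).
Proof.
move=> [u0 _ uK _]; case: i => [_|i il]; last exact: (uK i il).1.
by rewrite u0 => x _; rewrite edot0l.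
Qed.

(** By induction [s] lies in the face of [u_i], where [v_(i+1)] vanishes, and [u_(i+1) + v_(i+1)] is
    in [L]. The range stops at [l] because the last sum need not be in [L]. *)
Lemma reduction_orthogonal K L l u v s : reduction K L l u v -> K s ->
  (forall y, y \in L -> edot y s = 0) ->
  forall i, (i <= l)%N -> edot (u i) s = 0.
Proof.
move=> [u0 v0 uvK uvL] Ks Ls; elim=> [|i IH il]; first by rewrite u0 edot0l.
have [_ /perpP vs] := uvK i (ltnW il).
have := Ls _ (uvL i il); rewrite edotDl vs ?addr0//.
by split=> //; exact/IH/ltnW.
Qed.

(** As [u_l] vanishes at the core point [s], it vanishes on [G]. So does [v_(l+1)], and only the
    nonnegative [u_(l+1)] remains. *)
Lemma reduction_sound K G L l u v s : reduction K L l u v -> convex_cone G ->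
  G `<=` K -> core G s -> (forall y, y \in L -> edot y s = 0) ->
  dual_cone G (u l.+1 + v l.+1).
Proof.
move=> uv cG GK sG Ls g Gg; have [Gs _] := sG.
have us := reduction_orthogonal uv (GK _ Gs) Ls (leqnn l).
have [t t0 Gt] := core_unit cG sG Gg.
have ug : edot (u l) g = 0.
  have := reduction_dual uv (leqnSn l) (GK _ Gt).
  rewrite edotDr us add0r edotNr edotZr oppr_ge0 pmulr_rle0// => ug.
  by apply/eqP; rewrite eq_le ug (reduction_dual uv (leqnSn l))//; exact: GK.
have [_ _ uvK _] := uv; have [uK /perpP vg] := uvK l (leqnn l).
by rewrite edotDl vg ?addr0; [apply/uK/GK|split=> //; exact: GK].
Qed.

Lemma exposed_face_decr K L k u v : strict_reduction K L k u v ->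
  forall i j, (i <= j <= k)%N -> exposed_face K (u j) `<=` exposed_face K (u i).
Proof.
move=> [_ lt] i j /andP[ij jk].
elim: j ij jk => [|j IH]; first by rewrite leqn0 => /eqP -> _ ?.
rewrite leq_eqVlt => /predU1P[-> _ ?//|ij jk].
by have [sub _] := lt j jk; apply: subset_trans sub (IH ij (ltnW jk)).
Qed.

(** Constant continuation by [(y, z)] after index [k]. It serves both to add a strict step and to
    pad a reduction to length [l]. *)
Lemma strict_reduction_extend K L k u v y z : strict_reduction K L k u v ->
  dual_cone K y -> perp (exposed_face K (u k)) z -> y + z \in L ->
  exposed_face K y `<=` exposed_face K (u k) ->
  forall l, (k <= l)%N ->
  let u' i := if (i <= k)%N then u i else y in
  let v' i := if (i <= k)%N then v i else z in reduction K L l u' v'.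
Proof.
move=> [uv lt] Ky kz yzL yk l kl u' v'; have [u0 v0 uvK uvL] := uv.
split; rewrite /u' /v' ?leq0n//= => i il; last first.
  by case: ltnP => ik //; exact: uvL.
split; first by case: ltnP => ik //; exact: (uvK i (ltnW ik)).1.
case: ltngtP => ik; first exact: (uvK i (ltnW ik)).2.
- by apply: perpS kz; exact: yk.
- by rewrite ik.
Qed.

(** A strict reduction of maximal length ends at a face with a core slack; otherwise the
    alternative, split by niceness, yields one more step. *)
Lemma facial_reduction K x0 l : nice_cone K -> convex_cone K -> K (b - A x0) ->
  (forall k u v, strict_reduction K (annihilator A b) k u v -> (k <= l)%N) ->
  exists u v x, reduction K (annihilator A b) l u v /\
    core (exposed_face K (u l)) (b - A x).
Proof.
move=> nK cK Kx0 ub; set L := annihilator A b.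
pose P k := `[< exists u v, strict_reduction K L k u v >].
have P0 : exists k, P k.
  exists 0%N; apply/asboolP; exists (fun=> 0), (fun=> 0); split=> //; split=> // i _.
  split; first by move=> x _; rewrite edot0l.
  by apply/perpP => x _; rewrite edot0l.
have Pub k : P k -> (k <= l)%N by move=> /asboolP[u [v /ub]].
case: (ex_maxnP P0 Pub) => k /[dup] /Pub kl /asboolP[u [v uvk]] kmax.
have [[u0 v0 uvK uvL] lt] := uvk.
have Kuk : dual_cone K (u k) by apply: reduction_dual uvk.1 (leqnSn k).
(* The faces decrease, so [v_k] is orthogonal to the face of [u_k] too, and new terms can be added
   to it. *)
have kvk : perp (exposed_face K (u k)) (v k).
  case: k uvk kmax uvK uvL lt {kl Kuk} => [|k] uvk kmax uvK uvL lt.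
    by rewrite v0; apply/perpP => x _; rewrite edot0l.
  by apply: perpS (uvK k (leqnSn k)).2; exact: (lt k (ltnSn k)).1.
have Lk : u k + v k \in L.
  case: k uvL {uvk kmax uvK lt kl Kuk kvk} => [|k] uvL.
    by rewrite u0 v0 addr0 mem0v.
  exact: uvL.
have [x xk] : exists x, core (exposed_face K (u k)) (b - A x).
  apply: (slater_alternative (x0 := x0)).
  - exact: exposed_face_cone.
  - split=> //; apply: reduction_orthogonal uvk.1 Kx0 _ _ (leqnn k) => y.
    exact: annihilator_slack.
  move=> y Fy yL; apply: contrapT => kNy.
  have [k1 [e [Kk1 ke yE]]] := nice_cone_decomposition nK cK Kuk Fy.
  have Fk1 := exposed_faceD Kuk Kk1.
  have [_ KD _] := dual_cone_cone K.
  have [_ pD _] := perp_cone (exposed_face K (u k)).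
  have := strict_reduction_extend uvk (KD _ _ Kuk Kk1) (pD _ _ kvk ke).
  rewrite addrACA -yE rpredD// Fk1 => /(_ isT (@subIsetl _ _ _) k.+1 (leqnSn k)).
  set u' := fun _ => _; set v' := fun _ => _ => uv'.
  suff /kmax : P k.+1 by rewrite ltnn.
  apply/asboolP; exists u', v'; split=> // i; rewrite ltnS leq_eqVlt.
  move=> /predU1P[->|ik]; rewrite /u'; last by rewrite ik (ltnW ik); exact: lt.
  rewrite ltnn leqnn Fk1; split; first exact: subIsetl.
  (* If the face did not shrink, [k1] would vanish on it, and so would [y = k1 + e]. *)
  move=> sub; apply: kNy; apply/perpP => s sF.
  by have [_ [_ k1s]] := sub _ sF; rewrite yE edotDl k1s add0r; move/perpP: ke; apply.
have := strict_reduction_extend uvk Kuk kvk Lk (fun _ H => H) kl.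
set u' := fun _ => _; set v' := fun _ => _ => uv'.
exists u', v', x; split=> //; rewrite /u'; case: leqP => // lk.
by have -> : l = k by apply/eqP; rewrite eqn_leq lk kl.
Qed.

(** The [k + 1] faces, in reverse order, form a chain; the [k] sums [u_i + v_i] are independent
    vectors of the annihilator. *)
Lemma strict_reduction_le K k u v : convex_cone K ->
  strict_reduction K (annihilator A b) k u v ->
  (k <= minn (longest_face_chain K - 1) (\dim (annihilator A b)))%N.
Proof.
move=> cK uvk; have [uv lt] := uvk; have [u0 v0 uvK uvL] := uv.
set L := annihilator A b in uvL *.
have uK i : (i <= k)%N -> dual_cone K (u i).
  by move=> ik; apply: reduction_dual uv _; rewrite leqW.
rewrite leq_min; apply/andP; split.
  (* The truncated subtraction needs a chain of length at least 1, namely [K] alone. *)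
  rewrite leq_subRL ?add1n//; last first.
    have : (1 <= longest_face_chain K)%N; last by [].
    apply: (face_chain_longest cK (F := fun _ : 'I_1 => K)).
    split=> [i|i j]; last by rewrite !ord1.
    split; last by exists 0; have [] := cK.
    by rewrite -[K in face _ K]exposed_face0; apply: exposed_face_face => // x _; rewrite edot0l.
  apply: (face_chain_longest cK (F := fun i : 'I_k.+1 => exposed_face K (u (k - i)%N))).
  split=> [i|i j ij].
    split; first by apply: exposed_face_face => //; apply: uK; rewrite leq_subr.
    by exists 0; have [] := exposed_face_cone (u (k - i)%N) cK.
  have [sub nsub] : exposed_face K (u (k - j).+1) `<` exposed_face K (u (k - j)%N).
    by apply: lt; have := ltn_ord j; lia.
  have sub' : exposed_face K (u (k - i)%N) `<=` exposed_face K (u (k - j).+1).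
    by apply: exposed_face_decr uvk _ _ _; have := ltn_ord j; lia.
  split; first exact: subset_trans sub' sub.
  by move=> H; apply: nsub; exact: subset_trans H sub'.
pose y i := u i.+1 + v i.+1.
pose e i : seq Y := [seq y j | j <- rev (iota 0 i)].
suff fe i : (i <= k)%N -> free (e i).
  have := fe k (leqnn k); rewrite /free => /eqP; rewrite size_map size_rev size_iota => <-.
  apply: dimvS; apply/span_subvP => _ /mapP[j + ->].
  by rewrite mem_rev mem_iota => /andP[_]; exact: uvL.
elim: i => [_|i IH ik]; first by rewrite /free span_nil dimv0.
have -> : e i.+1 = y i :: e i by rewrite /e -addn1 iotaD rev_cat.
(* On the face of [u_i] all earlier sums vanish, and so does [v_(i+1)]. If the next sum depended on
   them, [u_(i+1)] would vanish there as well, and the face would not shrink. *)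
rewrite free_cons IH ?(ltnW ik)// andbT; apply/negP => ye.
have [sub nsub] := lt i ik; apply: nsub => x xi; split; first by case: xi.
have [_ /perpP vx] := uvK i (ltnW ik); have {vx} := vx _ xi.
have : edot (y i) x = 0.
  suff : y i \in lker (linfun (edotr x)).
    by rewrite memv_ker lfunE/= /edotr edotC => /eqP.
  apply: subvP ye; apply/span_subvP => _ /mapP[j + ->].
  rewrite mem_rev mem_iota add0n => /andP[_ ji]; rewrite memv_ker lfunE/= /edotr edotC.
  have jk := ltn_trans ji ik; have [_ /perpP vjx] := uvK j (ltnW jk).
  rewrite edotDl vjx ?addr0; last by apply: exposed_face_decr uvk _ _ _ _ xi; rewrite (ltnW ji) ltnW.
  by have [_ ->] : exposed_face K (u j.+1) x by apply: exposed_face_decr uvk _ _ _ _ xi; rewrite ji ltnW.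
by rewrite edotDl => + vx; rewrite vx addr0.
Qed.

Lemma dual_minimal_cone K x0 l : nice_cone K -> convex_cone K -> K (b - A x0) ->
  (forall k u v, strict_reduction K (annihilator A b) k u v -> (k <= l)%N) ->
  exists x, let G := minimal_cone A b K in
    [/\ convex_cone G, G `<=` K, forall w : X, K (b - A w) -> G (b - A w),
      core G (b - A x) & forall y, dual_cone G y <->
        exists u v, reduction K (annihilator A b) l u v /\ y = u l.+1 + v l.+1].
Proof.
move=> nK cK Kx0 ub; have [u [v [x [uv xl]]]] := facial_reduction nK cK Kx0 ub.
have Kul := reduction_dual uv (leqnSn l).
have FK := exposed_face_face cK Kul.
have feasF (w : X) : K (b - A w) -> exposed_face K (u l) (b - A w).
  move=> Kz; split=> //; apply: (reduction_orthogonal uv Kz) => // y.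
  exact: annihilator_slack.
have GE := minimal_coneE (convex_cone_cvx cK) FK feasF xl.
exists x => /=; rewrite GE; split=> //.
- exact: exposed_face_cone.
- by move=> ? [].
move=> y; split=> [yF|[u' [v' [uv' ->]]]]; last first.
  apply: (reduction_sound uv' (exposed_face_cone _ cK) _ xl) => [? []//|z].
  exact: annihilator_slack.
have [k [e [Kk Fe ->]]] := nice_cone_decomposition nK cK Kul yF.
have [u0 v0 uvK uvL] := uv.
(* Only the last pair is replaced; no other constraint involves it. *)
exists (fun i => if i == l.+1 then k else u i), (fun i => if i == l.+1 then e else v i).
rewrite !eqxx; split=> //; split=> //= i il; last by rewrite eqSS ltn_eqF//; exact: uvL.
rewrite eqSS [i == l.+1]ltn_eqF//; case: eqP => [->//|_]; exact: uvK.
Qed.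

(** Factors are chosen backwards from [mu_(l+1) = 1], which preserves the last sum: once [mu_(n+1)]
    is fixed, the scaling property at [u_n] for the tangent vector [mu_(n+1) v_(n+1)] gives
    [mu_n]. *)
Lemma reduction_rescale K (tan' : Y -> set Y) L l u v : closed K -> convex_cone K ->
  (forall y, dual_cone K y -> forall z, tangent_space y (dual_cone K) z ->
      exists2 lam : R, 0 < lam & tan' (lam *: y) z) ->
  reduction K L l u v -> exists u' v', [/\ u' 0%N = 0, v' 0%N = 0,
    forall i, (i <= l)%N -> dual_cone K (u' i.+1) /\ tan' (u' i) (v' i.+1),
    forall i, (i < l)%N -> u' i.+1 + v' i.+1 \in L &
    u' l.+1 + v' l.+1 = u l.+1 + v l.+1].
Proof.
move=> clK cK tanP uv; have [u0 v0 uvK uvL] := uv.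
have [mu [mu0 muN muP]] : exists mu : nat -> R, [/\ forall i, 0 < mu i, mu l.+1 = 1 &
    forall i, (i <= l)%N -> tan' (mu i *: u i) (mu i.+1 *: v i.+1)].
  suff : forall n (m : R), 0 < m -> (n <= l.+1)%N -> exists mu : nat -> R,
      [/\ forall i, 0 < mu i, mu n = m &
      forall i, (i < n)%N -> tan' (mu i *: u i) (mu i.+1 *: v i.+1)].
    by move=> /(_ l.+1 1); apply.
  elim=> [|n IH] m m0 nl; first by exists (fun=> m).
  have [_ uvn] := uvK n nl; have [_ _ pZ] := perp_cone (exposed_face K (u n)).
  have /tangent_spaceP := pZ _ _ (ltW m0) uvn.
  have Kun := reduction_dual uv (ltnW nl).
  move=> /(_ clK cK Kun)/(tanP _ Kun)[lam lam0 lamP].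
  have [mu [mu0 mun muP]] := IH _ lam0 (ltnW nl).
  exists (fun i => if i == n.+1 then m else mu i); split.
  - by move=> i; case: ifP.
  - by rewrite eqxx.
  move=> i; rewrite ltnS => il; rewrite [i == n.+1]ltn_eqF// eqSS.
  move: il; rewrite leq_eqVlt => /predU1P[->|il]; first by rewrite eqxx mun.
  by rewrite ltn_eqF//; exact: muP.
exists (fun i => mu i *: u i), (fun i => mu i *: v i); split.
- by rewrite u0 scaler0.
- by rewrite v0 scaler0.
- move=> i il; split; last exact: muP.
  by have [_ _ dZ] := dual_cone_cone K; apply: dZ (ltW (mu0 _)) (uvK i il).1.
- by move=> i il; rewrite -scalerDr rpredZ// uvL.
- by rewrite muN !scale1r.
Qed.

Section ExtendedDual.
Variables (K : set Y) (tan' : Y -> set Y) (L : {vspace Y}) (l : nat).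
Hypotheses (clK : closed K) (cK : convex_cone K).
Hypothesis tan'_sub : forall y, dual_cone K y ->
  tan' y `<=` tangent_space y (dual_cone K).
Hypothesis tan'_scale : forall y, dual_cone K y ->
  forall z, tangent_space y (dual_cone K) z ->
  exists2 lam : R, 0 < lam & tan' (lam *: y) z.

Lemma ext_nice_simpleP z :
  (exists u v, reduction K L l u v /\ z = u l.+1 + v l.+1) <->
  exists2 uv : l.+2.-tuple Y * l.+2.-tuple Y, ext_nice_simple K tan' L uv.1 uv.2 &
    uv.1`_l.+1 + uv.2`_l.+1 = z.
Proof.
split=> [[u [v [uv ->]]]|[[u v] /= [u0 v0 uvK uvL] <-]]; last first.
  exists (fun i => u`_i), (fun i => v`_i); split=> //; split=> // i il; last first.
    exact: uvL.
  have [Ku tu] := uvK i.+1 il; split=> //; apply/tangent_spaceP => //.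
    case: i il {Ku tu} => [|i] il; first by rewrite u0 => x _; rewrite edot0l.
    by have [] := uvK i.+1 (ltnW il).
  apply: tan'_sub tu.
  case: i il {Ku} => [|i] il; first by rewrite u0 => x _; rewrite edot0l.
  by have [] := uvK i.+1 (ltnW il).
have [u' [v' [u0 v0 uvK uvL <-]]] := reduction_rescale clK cK tan'_scale uv.
have tupleE (f : nat -> Y) :
    exists t : l.+2.-tuple Y, forall i, (i <= l.+1)%N -> t`_i = f i.
  exists [tuple of map f (iota 0 l.+2)] => i il.
  by rewrite (nth_map 0%N) ?size_iota// nth_iota.
have [[U UE] [V VE]] := (tupleE u', tupleE v').
exists (U, V); last by rewrite /= UE// VE.
split; rewrite /= ?UE ?VE//; case=> // i /andP[_ il].
  by rewrite UE// VE// UE ?(ltnW il)//; exact: uvK.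
by rewrite UE ?VE ?(leqW il)//; exact: uvL.
Qed.

End ExtendedDual.

End FacialReduction.

(** * Positive semidefinite matrices *)

Section PsdMatrices.
Variables (R : realType).

Definition qf n (M : 'M[R]_n) (x y : 'cV[R]_n) : R := (x^T *m M *m y) 0 0.

Lemma qfDl n (M : 'M[R]_n) x y z : qf M (x + y) z = qf M x z + qf M y z.
Proof. by rewrite /qf linearD/= !mulmxDl mxE. Qed.
Lemma qfDr n (M : 'M[R]_n) x y z : qf M z (x + y) = qf M z x + qf M z y.
Proof. by rewrite /qf mulmxDr mxE. Qed.
Lemma qfZl n (M : 'M[R]_n) a x y : qf M (a *: x) y = a * qf M x y.
Proof. by rewrite /qf linearZ/= -!scalemxAl mxE. Qed.
Lemma qfZr n (M : 'M[R]_n) a x y : qf M x (a *: y) = a * qf M x y.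
Proof. by rewrite /qf -scalemxAr mxE. Qed.
Lemma qfC n (M : 'M[R]_n) x y : M^T = M -> qf M x y = qf M y x.
Proof.
by move=> MT; rewrite /qf -[in LHS](trmxK (_ *m y)) mxE !trmx_mul trmxK MT mulmxA.
Qed.
Lemma qfB n (M N : 'M[R]_n) x y : qf (M - N) x y = qf M x y - qf N x y.
Proof. by rewrite /qf mulmxBr mulmxBl !mxE. Qed.
Lemma qfZ n (M : 'M[R]_n) a x y : qf (a *: M) x y = a * qf M x y.
Proof. by rewrite /qf -scalemxAr -scalemxAl mxE. Qed.
Lemma qf_conj m n (M : 'M[R]_n) (P : 'M[R]_(n, m)) x y :
  qf (P^T *m M *m P) x y = qf M (P *m x) (P *m y).
Proof. by rewrite /qf trmx_mul !mulmxA. Qed.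

Lemma qf_outer n k (q : 'M[R]_(n, k)) x :
  qf (q *m q^T) x x = \sum_j (x^T *m q) 0 j ^+ 2.
Proof.
rewrite /qf mulmxA -mulmxA -[q^T *m x]trmxK trmx_mul trmxK mxE.
by apply: eq_bigr => j _; rewrite [in X in _ * X]mxE.
Qed.

Lemma qf1_eq0 n (x : 'cV[R]_n) : (x^T *m x) 0 0 = 0 -> x = 0.
Proof.
rewrite mxE => /eqP; rewrite psumr_eq0 => [/allP x0|i _]; last first.
  by rewrite mxE -expr2 sqr_ge0.
apply/colP => i; have := x0 i (mem_index_enum i).
by rewrite !mxE mulf_eq0 orbb => /eqP.
Qed.

Lemma psdP n (M : 'M[R]_n) : psdmx M <-> M^T = M /\ forall x, 0 <= qf M x x.
Proof. by []. Qed.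

Lemma psd_cauchy_schwarz n (M : 'M[R]_n) x y : psdmx M ->
  qf M x y ^+ 2 <= qf M x x * qf M y y.
Proof.
move=> [MT M0]; have pos t : 0 <= qf M x x + 2 * t * qf M x y + t ^+ 2 * qf M y y.
  have := M0 (x + t *: y); rewrite -/(qf M _ _) qfDl !qfDr !qfZl !qfZr (qfC y x MT).
  by congr (_ <= _); ring.
have y0 : 0 <= qf M y y := M0 y.
have [yy|yy] := eqVneq (qf M y y) 0.
  rewrite yy mulr0; suff -> : qf M x y = 0 by rewrite expr0n.
  apply/eqP; apply: contraT => xy.
  (* This [t] makes the polynomial equal to -1. *)
  have := pos (- (qf M x x + 1) / (2 * qf M x y)); rewrite yy mulr0 addr0.
  have -> : 2 * (- (qf M x x + 1) / (2 * qf M x y)) * qf M x y = - (qf M x x + 1).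
    by field.
  by lra.
have {}yy : 0 < qf M y y by rewrite lt_neqAle eq_sym yy.
have := pos (- qf M x y / qf M y y).
rewrite -(pmulr_lge0 _ yy) -[in X in _ -> X]subr_ge0; congr (_ <= _).
by field; rewrite gt_eqF.
Qed.

(** Cauchy-Schwarz for [M x] and [x]: the mixed term is the squared norm of [M x]. *)
Lemma psd_ker n (M : 'M[R]_n) x : psdmx M -> qf M x x = 0 -> M *m x = 0.
Proof.
move=> psdM x0; have [MT _] := psdM; apply: qf1_eq0.
have := psd_cauchy_schwarz (M *m x) x psdM; rewrite x0 mulr0 => H.
have /eqP : qf M (M *m x) x ^+ 2 == 0 by rewrite eq_le H sqr_ge0.
by rewrite /qf -mulmxA => /eqP; rewrite sqrf_eq0 => /eqP.
Qed.

Lemma col_mulmx m n k (M : 'M[R]_(m, n)) (q : 'M[R]_(n, k)) j :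
  col j (M *m q) = M *m col j q.
Proof. by apply/colP => i; rewrite !mxE; apply: eq_bigr => l _; rewrite !mxE. Qed.

Lemma mulmx_col_eq0 n k (M : 'M[R]_n) (q : 'M[R]_(n, k)) :
  (forall j, M *m col j q = 0) -> M *m q = 0.
Proof.
move=> Mq; apply/matrixP => i j; have := Mq j; rewrite -col_mulmx => /colP/(_ i).
by rewrite !mxE.
Qed.

Lemma mulmx_cV_eq0 n (M : 'M[R]_n) : (forall x : 'cV_n, M *m x = 0) -> M = 0.
Proof. by move=> M0; rewrite -[M]mulmx1; exact: mulmx_col_eq0. Qed.

(** Row spaces are ordered oppositely to kernels; it suffices to test the columns of the
    cokernel. *)
Lemma submx_of_ker n (M N : 'M[R]_n) :
  (forall y : 'cV_n, N *m y = 0 -> M *m y = 0) -> (M <= N)%MS.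
Proof.
move=> MN; rewrite submxE; apply/eqP/mulmx_col_eq0 => j; apply: MN.
by rewrite -col_mulmx mulmx_coker linear0.
Qed.

Lemma psd_outer n k (q : 'M[R]_(n, k)) : psdmx (q *m q^T).
Proof.
apply/psdP; rewrite trmx_mul trmxK; split=> // x; rewrite qf_outer.
by apply: sumr_ge0 => j _; exact: sqr_ge0.
Qed.

(** Subtracting [a^-1 w w^T] with [w = M x] keeps the matrix positive semidefinite, by
    Cauchy-Schwarz, and lowers the rank, as [x] enters the kernel. *)
Lemma psd_factor n (M : 'M[R]_n) : psdmx M ->
  exists k (q : 'M[R]_(n, k)), M = q *m q^T.
Proof.
move: {2}(\rank M) (leqnn (\rank M)) => r.
elim: r M => [|r IH] M rM psdM.
  exists 0%N, 0; apply/eqP; rewrite mul0mx -mxrank_eq0; lia.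
have [M0|MN0] := pselect (forall x, qf M x x = 0).
  exists 0%N, 0; rewrite mul0mx; apply: mulmx_cV_eq0 => x; exact: psd_ker.
have /existsNP[x /eqP x0] := MN0.
have [MT Mpos] := psdM.
have {}x0 : 0 < qf M x x by rewrite lt_neqAle eq_sym x0 Mpos.
set a := qf M x x in x0; pose w := M *m x.
have wT : w^T = x^T *m M by rewrite trmx_mul MT.
have psdM' : psdmx (M - a^-1 *: (w *m w^T)).
  apply/psdP; split; first by rewrite linearB linearZ/= trmx_mul trmxK MT.
  move=> y; rewrite qfB qfZ qf_outer big_ord1 subr_ge0 ler_pdivrMl//.
  by have := psd_cauchy_schwarz y x psdM; rewrite /qf -/w mulmxA mulrC.
have sub : (M - a^-1 *: (w *m w^T) <= M)%MS.
  by rewrite wT mulmxA scalemxAl -{1}[M]mul1mx -mulmxBl submxMl.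
have [|k [q qE]] := IH _ _ psdM'.
  rewrite -ltnS (leq_trans _ rM)//.
  rewrite ltn_neqAle (mxrankS sub) andbT; apply/negP => /eqP rE.
  have : (M <= M - a^-1 *: (w *m w^T))%MS.
    by rewrite -(geq_leqif (mxrank_leqif_sup sub)) rE.
  move=> /submxP[D ME]; have Mx : M *m x = 0.
    rewrite ME -mulmxA mulmxBl -scalemxAl -mulmxA -/w.
    have -> : w^T *m x = a%:M by rewrite wT [LHS]mx11_scalar.
    by rewrite mul_mx_scalar scalerA mulVf ?gt_eqF// scale1r subrr mulmx0.
  by move: x0; rewrite /a /qf -mulmxA Mx mulmx0 mxE ltxx.
exists (k + 1)%N, (row_mx q (Num.sqrt a^-1 *: w)).
rewrite tr_row_mx mul_row_col -qE [(_ *: w)^T]linearZ/= -!(scalemxAl, scalemxAr) scalerA.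
by rewrite -expr2 sqr_sqrtr ?subrK// invr_ge0 ltW.
Qed.

(** Range inclusion lets [x] be factored as [(r p) (r p)^T]; Cauchy-Schwarz for the form [r] then
    bounds each square by a multiple of [qf r y y]. *)
Lemma psd_dominated n (r x : 'M[R]_n) : psdmx r -> psdmx x -> (x <= r)%MS ->
  exists2 lam : R, 1 < lam & psdmx (lam *: r - x).
Proof.
move=> psdr psdx xr; have [[rT r0] [xT x0]] := (psdr, psdx).
have [k [q xE]] := psd_factor psdx.
have [N xN] : exists N, x *m N *m r = x by exists (pinvmx r); exact: mulmxKpV.
pose p := N^T *m q.
have Nx : r *m N^T *m x = x.
  by have := congr1 trmx xN; rewrite !trmx_mul rT xT mulmxA.
have {}xE : x = (r *m p) *m (r *m p)^T.
  by rewrite /p !trmx_mul trmxK rT !mulmxA -(mulmxA _ q q^T) -xE Nx xN.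
pose lam := \sum_j qf r (col j p) (col j p).
have lam0 : 0 <= lam by apply: sumr_ge0 => j _; exact: r0.
(* The added 2 makes the factor exceed 1, which later puts [r] strictly inside a segment. *)
exists (lam + 2); first by lra.
apply/psdP; split; first by rewrite linearB linearZ/= rT xT.
move=> y; rewrite qfB qfZ subr_ge0 xE qf_outer.
apply: (@le_trans _ _ (lam * qf r y y)); last first.
  by rewrite ler_wpM2r ?lerDl//; exact: r0.
rewrite /lam mulr_suml; apply: ler_sum => j _.
have -> : (y^T *m (r *m p)) 0 j = qf r y (col j p).
  by rewrite /qf -[col j p]/(_ j p) -col_mulmx [RHS]mxE mulmxA.
by rewrite mulrC psd_cauchy_schwarz.
Qed.

(** Schur complement, by completing the square. *)
Lemma psd_block n (u w : 'M[R]_n) : psdmx (u - w *m w^T) ->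
  psdmx (block_mx u w w^T 1%:M).
Proof.
move=> /psdP[uT u0]; apply/psdP; split.
  rewrite tr_block_mx trmxK trmx1; congr block_mx.
  move: uT; rewrite linearB/= trmx_mul trmxK => /(congr1 (fun M => M + w *m w^T)).
  by rewrite !subrK.
move=> x; rewrite -[x]vsubmxK; set y := usubmx x; set z := dsubmx x.
suff -> : qf (block_mx u w w^T 1%:M) (col_mx y z) (col_mx y z) =
    qf (u - w *m w^T) y y + ((w^T *m y + z)^T *m (w^T *m y + z)) 0 0.
  rewrite addr_ge0// mxE; apply: sumr_ge0 => i _.
  by rewrite [in X in X * _]mxE -expr2 sqr_ge0.
rewrite qfB /qf tr_col_mx mul_row_block mul_row_col mulmx1.
rewrite [(_ + _)^T]linearD/= trmx_mul trmxK !(mulmxDl, mulmxDr) !mulmxA.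
have D (B C : 'M[R]_1) : (B + C) 0 0 = B 0 0 + C 0 0 by rewrite mxE.
by rewrite !D; ring.
Qed.

(** The form of the block matrix is zero at [(y, 0)], which is therefore in its kernel; the lower
    block reads [w^T y = 0]. *)
Lemma psd_block_ker n (u w : 'M[R]_n) y : psdmx (block_mx u w w^T 1%:M) ->
  qf u y y = 0 -> w^T *m y = 0.
Proof.
move=> psdB uy; have := @psd_ker _ _ (col_mx y 0) psdB.
rewrite /qf tr_col_mx mul_row_block mul_row_col mul_block_col !mulmx0 !addr0.
rewrite trmx0 !mul0mx !addr0 => /(_ uy); rewrite -col_mx0.
by move=> /eq_col_mx[].
Qed.

End PsdMatrices.

(** * The semidefinite cone *)

Section SymmetricMatrices.
Variables (R : realType) (n : nat).
Implicit Types (x z u v : 'S[R]_n) (E : set 'S[R]_n).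

Local Notation K := (psd_cone R n).

Lemma sym_tr x : (mx_of_sym x)^T = x.
Proof. by apply/eqP; rewrite -mem_symmx_vs; exact: subvsP. Qed.

Definition sym_of (M : 'M[R]_n) : 'S[R]_n := vsproj (symmx_vs R n) M.

Lemma sym_ofK (M : 'M[R]_n) : M^T = M -> mx_of_sym (sym_of M) = M.
Proof. by move=> /eqP MT; apply: vsprojK; rewrite mem_symmx_vs. Qed.

Lemma edot_trace x z : edot x z = \tr (mx_of_sym x *m mx_of_sym z).
Proof.
rewrite /mxtrace -[LHS]/(mxdot x z) /mxdot; apply: eq_bigr => i _.
by rewrite mxE; apply: eq_bigr => j _; rewrite -{1}(sym_tr z) mxE.
Qed.

Lemma edot_outer z x k (q : 'M[R]_(n, k)) : mx_of_sym x = q *m q^T ->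
  edot z x = \sum_j qf z (col j q) (col j q).
Proof.
move=> xE; rewrite edot_trace xE mulmxA mxtrace_mulC mulmxA; apply: eq_bigr => j _.
rewrite /qf !mxE; apply: eq_bigr => i _; rewrite !mxE; congr (_ * _).
by apply: eq_bigr => l _; rewrite !mxE.
Qed.

Lemma edot_outer1 z x (q : 'cV[R]_n) : mx_of_sym x = q *m q^T -> edot z x = qf z q q.
Proof. by move=> /(edot_outer z) ->; rewrite big_ord1 col_id. Qed.

Definition outer (q : 'cV[R]_n) : 'S[R]_n := sym_of (q *m q^T).

Lemma outerE q : mx_of_sym (outer q) = q *m q^T.
Proof. by apply: sym_ofK; rewrite trmx_mul trmxK. Qed.

Lemma outer_psd q : K (outer q).
Proof. by rewrite /psd_cone/= outerE; exact: psd_outer. Qed.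

Lemma edot_psd_ge0 z x : K z -> K x -> 0 <= edot z x.
Proof.
move=> [_ z0] /psd_factor[k [q xE]]; rewrite (edot_outer z xE).
by apply: sumr_ge0 => j _; exact: z0.
Qed.

Lemma psd_coneP z : K z <-> forall q, 0 <= edot z (outer q).
Proof.
split=> [Kz q|z0]; first by apply: edot_psd_ge0 => //; exact: outer_psd.
by apply/psdP; rewrite sym_tr; split=> // q; rewrite -(edot_outer1 _ (outerE q)).
Qed.

(** Being a dual cone gives both convexity and closedness. *)
Lemma psd_cone_dual : K = dual_cone (range outer).
Proof.
apply/seteqP; split=> z; first by move=> /psd_coneP z0 _ [q _ <-].
by move=> z0; apply/psd_coneP => q; apply: z0; exists q.
Qed.

Lemma psd_convex_cone : convex_cone K.
Proof. by rewrite psd_cone_dual; exact: dual_cone_cone. Qed.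

Lemma psd_closed : closed K.
Proof. by rewrite psd_cone_dual; exact: dual_cone_closed. Qed.

Lemma dual_psd_cone : dual_cone K = K.
Proof.
apply/seteqP; split=> z Kz; last by move=> x; exact: edot_psd_ge0.
by apply/psd_coneP => q; apply: Kz; exact: outer_psd.
Qed.

Lemma psd_orthogonal u x k (q : 'M[R]_(n, k)) : K u -> mx_of_sym x = q *m q^T ->
  edot u x = 0 -> forall j, qf u (col j q) (col j q) = 0.
Proof.
move=> [_ u0] /(edot_outer u) -> /eqP; rewrite psumr_eq0 => [/allP qu j|j _]; last exact: u0.
by apply/eqP; exact: (qu j (mem_index_enum j)).
Qed.

Lemma psd_core_face E r x : face K E -> E r -> K x ->
  (mx_of_sym x <= mx_of_sym r)%MS -> E x.
Proof.
move=> [EK _ KE] Er Kx xr; have [lam lam1 psdx] := psd_dominated (EK _ Er) Kx xr.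
have [_ KD KZ] := psd_convex_cone.
have lam1' : 0 < lam - 1 by rewrite subr_gt0.
have Ky : K (lam *: r - x) by rewrite /psd_cone/= linearB linearZ.
(* The point [r] divides the segment from [(lam r - x) / (lam - 1)] to [x] at parameter
   [1 / lam]. *)
have [] // := KE _ x (KZ (lam - 1)^-1 _ _ Ky) Kx; first by rewrite invr_ge0 ltW.
exists r; split=> //; exists lam^-1.
rewrite invr_gt0 invf_lt1 ?(lt_trans ltr01 lam1)//; split=> //.
apply: crdP => i; rewrite !crdE; field.
by rewrite !gt_eqF// (lt_trans ltr01 lam1).
Qed.

(** If [r y = 0], positivity of [r + t (r - x)] at [y] forces the form of [x] to vanish at [y]. *)
Lemma core_psd_face E r x : face K E -> core E r -> E x ->
  (mx_of_sym x <= mx_of_sym r)%MS.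
Proof.
move=> [EK _ _] [Er Dr] Ex; have [t t0 /EK [_ Ky]] := Dr x Ex.
apply: submx_of_ker => y ry; apply: psd_ker (EK _ Ex) _.
have := Ky y; rewrite -/(qf _ _ _) linearD linearZ linearB/= => yy.
have r0 : qf (mx_of_sym r) y y = 0 by rewrite /qf -mulmxA ry mulmx0 mxE.
have : 0 <= - (t * qf x y y).
  apply: le_trans yy _; rewrite /qf mulmxDr mulmxDl mxE -/(qf _ _ _) -/(qf (t *: _) _ _).
  by rewrite qfZ qfB r0 add0r mulrN -[X in X - _]/(qf (mx_of_sym r) y y) r0 sub0r.
rewrite oppr_ge0 pmulr_rle0// => xy.
by have [_ x0] := EK _ Ex; apply/eqP; rewrite eq_le xy x0.
Qed.

(* For a face [E] with relative interior point [r], the sum consists of the [z]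
   such that [r z r] is positive semidefinite. *)
Lemma psd_nice : nice_cone K.
Proof.
have [K0 KD KZ] := psd_convex_cone.
split; first exact/(closed_convex_coneE (ex_intro _ _ K0))/(conj psd_closed psd_convex_cone).
move=> E KE; rewrite dual_psd_cone.
(* The empty set is a face too; its orthogonal is the whole space. *)
have [[p Ep]|E0] := pselect (E !=set0); last first.
  suff -> : [set y + z | y in K & z in perp E] = setT by exact: closedT.
  apply/seteqP; split=> // z _; exists 0 => //; exists z; rewrite ?add0r//.
  by apply/perpP => x Ex; exfalso; apply: E0; exists x.
have [EK /cvxP cE _] := KE.
have [r rE] := core_ex cE Ep; have [Er _] := rE.
have [rT _] := EK _ Er.
suff -> : [set y + z | y in K & z in perp E] =
    dual_cone (range (fun q : 'cV[R]_n => outer (mx_of_sym r *m q))).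
  exact: dual_cone_closed.
apply/seteqP; split=> z.
  move=> [k Kk [e /perpP Ee <-]] _ [q _ <-].
  rewrite edotDl Ee ?addr0; first by apply: edot_psd_ge0 => //; exact: outer_psd.
  apply: psd_core_face KE Er (outer_psd _) _.
  by rewrite outerE trmx_mul rT mulmxA submxMl.
have [N rN] : exists N, forall x : 'M[R]_n, (x <= mx_of_sym r)%MS ->
    x *m N *m mx_of_sym r = x.
  by exists (pinvmx (mx_of_sym r)) => x; exact: mulmxKpV.
(* Multiplication by [M] on the left and by [M^T] on the right fixes every matrix of [E], so [z] and
   [M^T z M] have the same inner products with [E]. *)
move=> z0; pose M := mx_of_sym r *m N^T.
pose k := sym_of (M^T *m mx_of_sym z *m M).
have kE : mx_of_sym k = M^T *m mx_of_sym z *m M.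
  by apply: sym_ofK; rewrite trmx_mul [(M^T *m _)^T]trmx_mul trmxK sym_tr mulmxA.
have Kk : K k.
  apply/psd_coneP => q; rewrite (edot_outer1 _ (outerE q)) kE qf_conj.
  by rewrite -(edot_outer1 _ (outerE _)) /M -mulmxA; apply: z0; exists (N^T *m q).
exists k => //; exists (z - k); last by rewrite addrC subrK.
apply/perpP => x Ex; rewrite edotDl edotNl !edot_trace kE.
have xN : mx_of_sym x *m N *m mx_of_sym r = mx_of_sym x by apply: rN; exact: core_psd_face rE Ex.
have xM : mx_of_sym x *m M^T = mx_of_sym x.
  by rewrite /M trmx_mul trmxK sym_tr mulmxA.
have Mx : M *m mx_of_sym x = mx_of_sym x.
  by rewrite -[RHS]sym_tr -[in RHS]xM trmx_mul trmxK sym_tr.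
rewrite -[_ *m M *m _]mulmxA Mx [X in _ - X]mxtrace_mulC mulmxA xM.
by rewrite mxtrace_mulC subrr.
Qed.

(** The choice of [tan'] for the semidefinite cone; the block condition means that [u - w w^T] is
    positive semidefinite. *)
Definition sdp_tangent u : set 'S[R]_n := [set v | exists w : 'M[R]_n,
  psdmx (block_mx (mx_of_sym u) w w^T 1%:M) /\ mx_of_sym v = w + w^T].

(** For [x = q q^T] orthogonal to [u], the columns of [q] are killed by [w^T], so the trace of [v x]
    is zero. *)
Lemma sdp_tangent_sub u : K u -> sdp_tangent u `<=` tangent_space u K.
Proof.
move=> Ku v [w [psdB vE]]; rewrite -dual_psd_cone; apply/tangent_spaceP.
- exact: psd_closed.
- exact: psd_convex_cone.
- by rewrite dual_psd_cone.
apply/perpP => x [/psd_factor[k [q xE]] ux].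
have wq : w^T *m q = 0.
  apply: mulmx_col_eq0 => j; apply: psd_block_ker psdB _.
  exact: psd_orthogonal xE ux j.
have qw : q^T *m w = 0 by rewrite -[LHS]trmxK trmx_mul trmxK wq trmx0.
rewrite edot_trace vE xE mulmxDl linearD/= mxtrace_mulC -!mulmxA qw mulmx0.
by rewrite !mulmxA wq mul0mx !mxtrace0 addr0.
Qed.

(** Orthogonality to the face means that the form of [v] is zero on the kernel of [u], which is the
    range of [T]. *)
Lemma sdp_tangent_scale u v : K u -> tangent_space u K v ->
  exists2 lam : R, 0 < lam & sdp_tangent (lam *: u) v.
Proof.
move=> Ku; rewrite -{1}dual_psd_cone => /(tangent_spaceP _ psd_closed psd_convex_cone).
rewrite dual_psd_cone => /(_ Ku)/perpP uv; have [uT _] := Ku.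
have [N uN] : exists N, mx_of_sym u *m N *m u = u.
  by exists (pinvmx u); apply: mulmxKpV; exact: submx_refl.
pose T := 1%:M - N *m u.
have uT0 : u *m T = 0 by rewrite mulmxBr mulmx1 mulmxA uN subrr.
have TvT : T^T *m v *m T = 0.
  have T0 y : qf (T^T *m v *m T) y y = 0.
    rewrite qf_conj -(edot_outer1 _ (outerE _)); apply: uv.
    split; first exact: outer_psd.
    by rewrite (edot_outer1 _ (outerE _)) /qf -mulmxA (mulmxA _ T) uT0 mul0mx mulmx0 mxE.
  apply: mulmx_cV_eq0 => y; apply: psd_ker (T0 y); apply/psdP; split.
    by rewrite !trmx_mul trmxK sym_tr mulmxA.
  by move=> x; rewrite T0.
(* With [P = u N^T], [T^T v T = 0] reads [v = P v + v P^T - P v P^T]; [w] takes the first term and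
   half of the last. The range of [w w^T] is in that of [u], so some [lam u] dominates it. *)
pose w := u *m N^T *m v *m (1%:M - 2^-1 *: (N *m u)).
have wT : w^T = (1%:M - 2^-1 *: (u *m N^T)) *m (mx_of_sym v *m N *m u).
  rewrite trmx_mul; congr (_ *m _).
    by rewrite linearB linearZ/= trmx1 trmx_mul uT.
  by rewrite !trmx_mul trmxK uT sym_tr mulmxA.
have wE : mx_of_sym v = w + w^T.
  have TT : T^T = 1%:M - u *m N^T by rewrite linearB/= trmx1 trmx_mul uT.
  move: TvT; rewrite wT TT /T /w.
  rewrite !(mulmxBl, mulmxBr, mul1mx, mulmx1) -!(scalemxAl, scalemxAr) !mulmxA.
  move=> H; apply/eqP; rewrite -subr_eq0 -H; apply/eqP.
  by apply: crdP => i; rewrite !crdE; field.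
have wu : (w *m w^T <= mx_of_sym u)%MS.
  by rewrite wT !mulmxA submxMl.
have [lam lam1 psdw] := psd_dominated Ku (psd_outer w) wu.
exists lam; first exact: lt_trans lam1.
by exists w; split=> //; apply: psd_block; rewrite linearZ.
Qed.

(** * Bounds on the number of steps in the semidefinite case *)

Lemma dim_symmx : (\dim {:'S[R]_n} <= n * n.+1 %/ 2)%N.
Proof.
pose lo (M : 'M[R]_n) : 'M[R]_n := \matrix_(i, j) if (j <= i)%N then M i j else 0.
have lol : linear lo.
  by move=> a M P; apply/matrixP => i j; rewrite !mxE; case: ifP; rewrite ?mxE ?mulr0 ?addr0.
pose loL : {linear 'M[R]_n -> 'M[R]_n} := HB.pack lo
  (GRing.isLinear.Build R 'M[R]_n 'M[R]_n *:%R lo lol).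
pose I := [pred p : 'I_n * 'I_n | p.2 <= p.1]%N.
pose e := [seq delta_mx p.1 p.2 : 'M[R]_n | p <- enum I].
have sz : size e = (n * n.+1 %/ 2)%N.
  rewrite size_map -cardE -sum1_card.
  rewrite -(pair_big_dep xpredT (fun i j : 'I_n => j <= i)%N (fun _ _ => 1%N))/=.
  have -> : (\sum_(i < n) \sum_(j < n | j <= i) 1 = \sum_(i < n) i.+1)%N.
    apply: eq_bigr => i _; rewrite -(big_ord_widen n (fun=> 1%N) (ltn_ord i)).
    by rewrite sum1_card card_ord.
  suff : (2 * \sum_(i < n) i.+1 = n * n.+1)%N by lia.
  elim: (n) => [|k IH]; first by rewrite big_ord0.
  by rewrite big_ord_recr/= mulnDr IH; ring.
have -> : \dim {:'S[R]_n} = \dim (symmx_vs R n) by rewrite dimvf.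
(* A symmetric matrix is determined by its lower triangle [lo M]. *)
have <- : \dim (linfun loL @: symmx_vs R n) = \dim (symmx_vs R n).
  apply: limg_dim_eq; apply/eqP; rewrite -subv0; apply/subvP => M.
  rewrite memv_cap mem_symmx_vs memv_ker lfunE/= memv0 => /andP[/eqP MT /eqP M0].
  apply/eqP/matrixP => i j; rewrite mxE; wlog ji : i j / (j <= i)%N.
    by move=> H; case: (leqP j i) => [|/ltnW] /H// <-; rewrite -{1}MT mxE.
  by have /matrixP/(_ i j) := M0; rewrite !mxE ji.
rewrite -sz; apply: leq_trans (dim_span e); apply: dimvS.
apply/subvP => _ /memv_imgP[M _ ->]; rewrite lfunE/= [lo M]matrix_sum_delta.
apply: memv_suml => i _; apply: memv_suml => j _; rewrite mxE.
case: ifP => ji; last by rewrite scale0r mem0v.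
apply/rpredZ/memv_span/mapP; exists (i, j) => //.
by rewrite mem_enum inE.
Qed.

(** Smaller faces mean smaller kernels of the [u_i]; equal ranks would give equal row spaces, hence
    equal faces. *)
Lemma sdp_strict_reduction_le L k (u v : nat -> 'S[R]_n) :
  strict_reduction K L k u v -> (k <= n)%N.
Proof.
move=> [uv lt]; suff H i : (i <= k)%N -> (i <= \rank (mx_of_sym (u i)))%N.
  by rewrite (leq_trans (H k (leqnn k)))// rank_leq_row.
have Ku j : (j <= k)%N -> K (u j).
  by move=> jk; rewrite -dual_psd_cone; apply: reduction_dual uv (leqW jk).
elim: i => // i IH ik; apply: leq_ltn_trans (IH (ltnW ik)) _.
have [sub nsub] := lt i ik.
have le : (mx_of_sym (u i) <= mx_of_sym (u i.+1))%MS.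
  apply: submx_of_ker => y uy; apply: psd_ker (Ku i (ltnW ik)) _.
  rewrite -(edot_outer1 _ (outerE y)); apply: (sub (outer y) _).2.
  split; first exact: outer_psd.
  by rewrite (edot_outer1 _ (outerE y)) /qf -mulmxA uy mulmx0 mxE.
rewrite ltn_neqAle (mxrankS le) andbT; apply/negP => /eqP rE; apply: nsub.
have /submxP[D uE] : (mx_of_sym (u i.+1) <= mx_of_sym (u i))%MS.
  by rewrite -(geq_leqif (mxrank_leqif_sup le)) rE.
move=> x [Kx ux]; split=> //; have [p [q xE]] := psd_factor Kx.
rewrite (edot_outer _ xE) big1// => j _; rewrite uE /qf -!mulmxA.
rewrite (psd_ker (Ku i (ltnW ik)) (psd_orthogonal (Ku i (ltnW ik)) xE ux j)).
by rewrite !mulmx0 mxE.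
Qed.

(** The annihilator is orthogonal to the [m + 1] independent matrices [a_i] and [b], so the
    dimensions add up. *)
Lemma dim_annihilator m (A : 'Hom(euclid R m, 'S[R]_n)) (a : 'I_m -> 'S[R]_n) b :
  (forall x : euclid R m, A x = \sum_(i < m) (x : 'rV[R]_m) 0 i *: a i) ->
  free (rcons [seq a i | i <- enum 'I_m] b) ->
  (\dim (annihilator A b) <= n * n.+1 %/ 2 - m - 1)%N.
Proof.
move=> AE; set g := rcons _ _ => fg.
have sz : size g = m.+1 by rewrite size_rcons size_map size_enum_ord.
have cap0 : (annihilator A b :&: <<g>> = 0)%VS.
  apply/eqP; rewrite -subv0; apply/subvP => y; rewrite memv_cap memv0 => /andP[yL yg].
  have [Ay by0] := annihilatorP _ _ _ yL.
  apply/eqP/edot_eq0; suff : y \in lker (linfun (edotr y)).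
    by rewrite memv_ker lfunE/= => /eqP.
  apply: subvP yg; apply/span_subvP => z; rewrite mem_rcons inE memv_ker lfunE/= /edotr.
  move=> /predU1P[->|/mapP[i _ ->]]; first by rewrite edotC by0.
  pose d : euclid R m := delta_mx 0 i.
  have <- : A d = a i.
    rewrite AE (bigD1 i)//= big1 ?addr0 => [|j ji]; first by rewrite mxE !eqxx scale1r.
    by rewrite mxE (negbTE ji) andbF scale0r.
  by rewrite edotC adjointP Ay edot0r.
have dg : \dim <<g>> = m.+1 by move: fg; rewrite /free sz => /eqP.
have : (\dim (annihilator A b + <<g>>) <= n * n.+1 %/ 2)%N.
  by apply: leq_trans dim_symmx; rewrite dimvS// subvf.
by rewrite dimv_disjoint_sum// dg; lia.
Qed.

End SymmetricMatrices.

(** * The extended dual *)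

(** Here [l] is any bound on the number of strict steps, to cover both the conic value of [l] and
    the semidefinite one. *)
Lemma extended_dual (R : realType) (X Y : euclideanType R) (A : 'Hom(X, Y)) (b : Y)
    (c : X) (K : set Y) (tan' : Y -> set Y) (l : nat) :
  nice_cone K -> feasible A b K !=set0 ->
  (forall u, dual_cone K u -> tan' u `<=` tangent_space u (dual_cone K)) ->
  (forall u, dual_cone K u -> forall v, tangent_space u (dual_cone K) v ->
    exists2 lam : R, 0 < lam & tan' (lam *: u) v) ->
  (forall k u v, strict_reduction K (annihilator A b) k u v -> (k <= l)%N) ->
  let EXT := [set uv : l.+2.-tuple Y * l.+2.-tuple Y |
               ext_nice_simple K tan' (annihilator A b) uv.1 uv.2] in
  let last_sum (uv : l.+2.-tuple Y * l.+2.-tuple Y) :=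
    uv.1`_l.+1 + uv.2`_l.+1 in
  dual_cone (minimal_cone A b K) = [set last_sum uv | uv in EXT] /\
  strong_duality (feasible A b K) (fun x => edot c x)
    [set uv | adjoint A (last_sum uv) = c /\ EXT uv]
    (fun uv => edot b (last_sum uv)).
Proof.
move=> nK [x0 Kx0] sub scale ub EXT last_sum.
have [clK cK] := (closed_convex_coneE (ex_intro K _ Kx0)).1 nK.1.
have [x [cG GK feasG slater GE]] := dual_minimal_cone nK cK Kx0 ub.
have dualE : dual_cone (minimal_cone A b K) = [set last_sum uv | uv in EXT].
  have EP := ext_nice_simpleP (annihilator A b) l clK cK sub scale.
  by apply/seteqP; split=> y; [move=> /GE/EP|move=> /EP/GE].
split=> //; apply: strong_duality_image (slater_strong_duality c cG GK feasG slater).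
rewrite dualE; apply/seteqP; split=> [_ [z [[uv Euv uvz] Az] <-]|_ [uv [Az Euv] <-]].
  by exists uv; rewrite /= uvz.
by exists (last_sum uv) => //; split=> //; exists uv.
Qed.

Lemma sdp_ext_dual_feasibleP (R : realType) (m n : nat)
    (A : 'Hom(euclid R m, 'S[R]_n)) (b : 'S[R]_n) (c : euclid R m) (l : nat)
    (u v : l.+2.-tuple 'S[R]_n) :
  (exists w, sdp_ext_dual_feasible A b c u v w) <->
  adjoint A (u`_l.+1 + v`_l.+1) = c /\
  ext_nice_simple (psd_cone R n) (@sdp_tangent R n) (annihilator A b) u v.
Proof.
rewrite /ext_nice_simple dual_psd_cone.
split=> [[w [Ac AL uw u0 v0]]|[Ac [u0 v0 uv uvL]]].
  split=> //; split=> // i il; last by apply/annihilatorP; exact: AL.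
  by have [Ku Bu vw] := uw i il; split=> //; exists w`_i.-1.
have wP (i : 'I_l.+1) : exists w : 'M[R]_n,
    psdmx (block_mx (mx_of_sym u`_i) w w^T 1%:M) /\ mx_of_sym v`_i.+1 = w + w^T.
  by have [_] := uv i.+1 (ltn_ord i).
have [w wE] := choice wP.
exists [tuple w i | i < l.+1]; split=> // [i il|[|i] //il].
  exact/annihilatorP/uvL.
have [Ku _] := uv i.+1 il; have [Bu vw] := wE (Ordinal il).
by rewrite /= (_ : _`_i = w (Ordinal il))// -[RHS]tnth_mktuple (tnth_nth 0).
Qed.

Theorem corollary3 (R : realType) :
  (forall (X Y : euclideanType R) (A : 'Hom(X, Y)) (b : Y) (c : X)
      (K : set Y) (tan' : Y -> set Y),
    nice_cone K ->
    feasible A b K !=set0 ->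
    (forall u, dual_cone K u -> tan' u `<=` tangent_space u (dual_cone K)) ->
    (forall u, dual_cone K u -> forall v, tangent_space u (dual_cone K) v ->
      exists2 lam : R, 0 < lam & tan' (lam *: u) v) ->
    let L := annihilator A b in
    let l := minn (longest_face_chain K - 1)%N (\dim L) in
    let EXT := [set uv : l.+2.-tuple Y * l.+2.-tuple Y |
                 ext_nice_simple K tan' L uv.1 uv.2] in
    let last_sum (uv : l.+2.-tuple Y * l.+2.-tuple Y) :=
      uv.1`_l.+1 + uv.2`_l.+1 in
    dual_cone (minimal_cone A b K) = [set last_sum uv | uv in EXT] /\
    strong_duality
      (feasible A b K) (fun x => edot c x)
      [set uv | adjoint A (last_sum uv) = c /\ EXT uv]
      (fun uv => edot b (last_sum uv))) /\
  (forall (m n : nat) (A : 'Hom(euclid R m, 'S[R]_n)) (a : 'I_m -> 'S[R]_n)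
      (b : 'S[R]_n) (c : euclid R m),
    (forall x : euclid R m, A x = \sum_(i < m) (x : 'rV[R]_m) 0 i *: a i) ->
    free (rcons [seq a i | i <- enum 'I_m] b) ->
    feasible A b (psd_cone R n) !=set0 ->
    let l := minn n (n * n.+1 %/ 2 - m - 1)%N in
    strong_duality
      (feasible A b (psd_cone R n)) (fun x => edot c x)
      [set uvw : l.+2.-tuple 'S[R]_n * l.+2.-tuple 'S[R]_n * l.+1.-tuple 'M[R]_n |
        sdp_ext_dual_feasible A b c uvw.1.1 uvw.1.2 uvw.2]
      (fun uvw : l.+2.-tuple 'S[R]_n * l.+2.-tuple 'S[R]_n * l.+1.-tuple 'M[R]_n =>
        edot b (uvw.1.1`_l.+1 + uvw.1.2`_l.+1))).
Proof.
split=> [X Y A b c K tan' nK feas sub scale L l EXT last_sum|].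
  have [x0 Kx0] := feas.
  have [_ cK] := (closed_convex_coneE (ex_intro K _ Kx0)).1 nK.1.
  by apply: extended_dual => // k u v; exact: strict_reduction_le.
move=> m n A a b c AE fab feas l.
have nK := psd_nice R n; have cK := psd_convex_cone R n.
(* The bound [n] comes from ranks, the other one from the dimension of the annihilator. *)
have ub k u v : strict_reduction (psd_cone R n) (annihilator A b) k u v -> (k <= l)%N.
  move=> uv; rewrite leq_min (sdp_strict_reduction_le uv).
  apply: leq_trans (dim_annihilator AE fab).
  by have := strict_reduction_le cK uv; rewrite leq_min => /andP[].
have [||_ sd] := extended_dual c (tan' := @sdp_tangent R n) nK feas _ _ ub.
- by rewrite dual_psd_cone; exact: sdp_tangent_sub.
- by rewrite dual_psd_cone => u Ku v; exact: sdp_tangent_scale.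
apply: strong_duality_image sd; apply/seteqP; split=> [_ [[u v] uvP <-]|_ [uvw uvwP <-]].
  by have /sdp_ext_dual_feasibleP[w uvw] := uvP; exists (u, v, w).
exists uvw.1 => //; apply/sdp_ext_dual_feasibleP; exists uvw.2; exact: uvwP.
Qed.
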